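(* For any $\alpha\in(0,1)$ and $K>0$, the set $\mathsf{H\ddot{o}l}^{\alpha}(K)$ is compact in the topology of $\mathrm{Diff}^1(\mathbb{T})/\mathrm{PSL}(2,\mathbb{R})$.
   Context: $\mathbb{T}=[0,1]/\{0\sim1\}$ is the unit circle; for $s,t\in\mathbb{T}$, $t-s\in[0,1)$ is the length of the arc from $s$ to $t$ in the positive direction, and $\mathsf{d}(s,t)=\min\{t-s,1-(t-s)\}$. $\mathrm{Diff}^1(\mathbb{T})$ is the space of orientation preserving $C^1$-diffeomorphisms of $\mathbb{T}$ with the $C^1$ topology. $\mathrm{PSL}(2,\mathbb{R})$ is the group of conformal automorphisms of the unit disk restricted to the boundary (identified with $\mathbb{T}$ via $t\mapsto e^{2\pi i t}$), acting on $\mathrm{Diff}^1(\mathbb{T})$ by post-composition; $\mathrm{Diff}^1(\mathbb{T})/\mathrm{PSL}(2,\mathbb{R})$ carries the quotient topology. For $\phi\in\mathrm{Diff}^1(\mathbb{T})$ and distinct $s,t\in\mathbb{T}$, $$\mathcal{O}(\phi;s,t)=\frac{\pi\sqrt{\phi'(t)\phi'(s)}}{\sin(\pi[\phi(t)-\phi(s)])},\qquad \phi(t)-\phi(s)\in(0,1);$$ it is invariant under post-composition by $\mathrm{PSL}(2,\mathbb{R})$, hence is defined on the quotient. $\mathsf{H\ddot{o}l}^{\alpha}(K)$ is the set of $\phi\in\mathrm{Diff}^1(\mathbb{T})/\mathrm{PSL}(2,\mathbb{R})$ such that $\left|\mathcal{O}(\phi;s,t)-\frac{\pi}{\sin(\pi[t-s])}\right|\le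 K\,\mathsf{d}(s,t)^{\alpha-1}$ for all distinct $s,t\in\mathbb{T}$. *)

(* Defs.v *)
From HB Require Import structures.
From mathcomp Require Import all_boot all_order all_algebra generic_quotient.
From mathcomp Require Import all_classical all_reals all_analysis.
From mathcomp Require Import complex lra.

Set Implicit Arguments.
Unset Strict Implicit.
Unset Printing Implicit Defensive.

Import Order.TTheory GRing.Theory Num.Theory.
Import numFieldNormedType.Exports.

Local Open Scope classical_set_scope.
Local Open Scope ring_scope.

(* [0,1]/{0~1}, a point being given by its representative in [0,1). *)
Record circle (R : realType) := Circle {
  circle_val : R;
  circle_valP : 0 <= circle_val < 1 }.

HB.instance Definition _ (R : realType) := [isSub for @circle_val R].
HB.instance Definition _ (R : realType) := [Choice of circle R by <:].

Lemma to_circle_subproof (R : realType) (x : R) :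
  0 <= x - (Num.floor x)%:~R < 1.
Proof.
by rewrite subr_ge0 floor_le ltrBlDr addrC -intrD1 floorD1_gt.
Qed.

Definition to_circle (R : realType) (x : R) : circle R :=
  Circle (to_circle_subproof x).

Section circle_metric.
Context {R : realType}.
Implicit Types s t u : circle R.

(* The length [t - s], in [0,1), of the arc from [s] to [t] in the positive
   direction. *)
Definition arc_len s t : R :=
  if circle_val s <= circle_val t then circle_val t - circle_val s
  else circle_val t - circle_val s + 1.

Definition cdist s t : R := Num.min (arc_len s t) (1 - arc_len s t).

Lemma cdistxx t : cdist t t = 0.
Proof. by rewrite /cdist /arc_len lexx subrr subr0 min_l. Qed.

Lemma cdist_cases s t :
  cdist s t = arc_len s t /\ arc_len s t <= 1 - arc_len s t \/
  cdist s t = 1 - arc_len s t /\ 1 - arc_len s t <= arc_len s t.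
Proof. by rewrite /cdist; case: (leP (arc_len s t)) => [?|/ltW ?]; [left|right]. Qed.

Lemma cdist_eq0 s t : cdist s t = 0 -> s = t.
Proof.
move=> st; apply: val_inj => /=; move: st.
have /andP[? ?] := circle_valP s; have /andP[? ?] := circle_valP t.
case: (cdist_cases s t) => -[-> ?]; rewrite /arc_len.
  by case: (leP (circle_val s) (circle_val t)) => ? ?; lra.
by case: (leP (circle_val s) (circle_val t)) => ? ?; lra.
Qed.

Lemma cdist_sym s t : cdist s t = cdist t s.
Proof.
have /andP[? ?] := circle_valP s; have /andP[? ?] := circle_valP t.
rewrite /cdist /arc_len.
case: (ltgtP (circle_val s) (circle_val t)) => [?|?|->]; last by [].
  by rewrite minC; congr Num.min; lra.
by rewrite minC; congr Num.min; lra.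
Qed.

Lemma cdist_triangle u s t : cdist s t <= cdist s u + cdist u t.
Proof.
have /andP[? ?] := circle_valP s; have /andP[? ?] := circle_valP t.
have /andP[? ?] := circle_valP u.
case: (cdist_cases s t) => -[-> +]; case: (cdist_cases s u) => -[-> +];
case: (cdist_cases u t) => -[-> +]; rewrite /arc_len;
case: (leP (circle_val s) (circle_val t)) => ?;
  case: (leP (circle_val s) (circle_val u)) => ?;
  case: (leP (circle_val u) (circle_val t)) => ? ? ? ?; lra.
Qed.

HB.instance Definition _ := isMetric.Build R (circle R)
  cdistxx cdist_eq0 cdist_sym cdist_triangle.

End circle_metric.

Section derivative.
Context {R : realType}.
Implicit Types (s t : circle R) (phi : circle R -> circle R).

(* The representative of [t - s] in [-1/2, 1/2): the coordinate of [t] in a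
   chart centred at [s]. *)
Definition signed_arc s t : R := if arc_len s t < 2^-1 then arc_len s t else arc_len s t - 1.

(* [phi] read in charts centred at [t] and [phi t]; it maps 0 to 0. *)
Definition in_chart phi t (h : R) : R :=
  signed_arc (phi t) (phi (to_circle (circle_val t + h))).

Definition cderiv phi t : R := derive1 (in_chart phi t) 0.

Definition C1 phi :=
  (forall t, derivable (in_chart phi t) 0 1) /\ continuous (cderiv phi).

Definition oriented_C1_diffeo phi :=
  exists psi : circle R -> circle R,
    [/\ cancel phi psi, cancel psi phi, C1 phi, C1 psi
      & forall t, 0 < cderiv phi t].

End derivative.

Record Diff1 (R : realType) := MkDiff1 {
  diff1_fun :> circle R -> circle R;
  diff1P : oriented_C1_diffeo diff1_fun }.

HB.instance Definition _ (R : realType) := gen_eqMixin (Diff1 R).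
HB.instance Definition _ (R : realType) := gen_choiceMixin (Diff1 R).

(* The C^1 topology is that of uniform convergence of the maps and of their
   derivatives. *)
Definition C1_jet (R : realType) (phi : Diff1 R) :
    {uniform circle R -> circle R} * {uniform circle R -> R} :=
  (diff1_fun phi, cderiv phi).

HB.instance Definition _ (R : realType) :=
  Uniform.copy (Diff1 R) (initial_topology (@C1_jet R)).

(* Going through [numClosedFieldType] is what gives [R[i]] its normed topology. *)
Definition Cplx (R : realType) : numClosedFieldType := R[i]%C.

Section conformal.
Context {R : realType}.
Local Notation C := (Cplx R).

Definition open_disk : set C := [set z | `|z| < 1].
Definition closed_disk : set C := [set z | `|z| <= 1].

(* Differentiability is over the field [C], hence complex. *)
Definition disk_holomorphic_map (f : C -> C) :=
  [/\ {homo f : z / open_disk z}, {homo f : z / closed_disk z},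
      forall z, open_disk z -> derivable f z 1
    & {within closed_disk, continuous f}].

(* Conformal automorphisms of the open disk, together with their continuous
   extension to the closed disk; the values of [f] and [g] outside the closed
   disk are irrelevant. *)
Definition conformal_automorphism (f : C -> C) :=
  disk_holomorphic_map f /\
  exists g : C -> C,
    [/\ disk_holomorphic_map g,
        forall z, closed_disk z -> g (f z) = z
      & forall z, closed_disk z -> f (g z) = z].

Definition circle_exp (t : circle R) : C :=
  Complex (cos (2 * pi * circle_val t)) (sin (2 * pi * circle_val t)).

Definition PSL2R : set (circle R -> circle R) :=
  [set g | exists2 f, conformal_automorphism f
         & forall t, f (circle_exp t) = circle_exp (g t)].

Lemma circle_exp_closed t : closed_disk (circle_exp t).
Proof.
by rewrite /closed_disk /= normc_def /= cos2Dsin2 sqrtr1.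
Qed.

Lemma disk_holomorphic_map_id : disk_holomorphic_map id.
Proof.
split=> //.
by apply: continuous_subspaceT => z; exact: cvg_id.
Qed.

Lemma disk_holomorphic_map_comp f g :
  disk_holomorphic_map f -> disk_holomorphic_map g ->
  disk_holomorphic_map (g \o f).
Proof.
move=> [fo fc fd fcont] [go gc gd gcont]; split.
- by move=> z /fo /go.
- by move=> z /fc /gc.
- move=> z zD; apply/derivable1_diffP; apply: differentiable_comp.
    by apply/derivable1_diffP; exact: fd.
  by apply/derivable1_diffP; apply: gd; exact: fo.
- apply/subspace_continuousP => z zD /=.
  move/subspace_continuousP: gcont => /(_ _ (fc _ zD)) gz.
  move/subspace_continuousP: fcont => /(_ _ zD) fz U /gz gU.
  have {}gU := fz _ gU.
  have {}gU : \forall w \near within closed_disk (nbhs z),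
    closed_disk (f w) -> U (g (f w)) by exact: gU.
  have wD : \forall w \near within closed_disk (nbhs z), closed_disk w.
    exact: withinT.
  by apply: filterS2 gU wD => w fwU /fc /fwU.
Qed.

Lemma conformal_automorphism_id : conformal_automorphism id.
Proof.
split; first exact: disk_holomorphic_map_id.
by exists id; split => //; exact: disk_holomorphic_map_id.
Qed.

Lemma conformal_automorphism_comp f g :
  conformal_automorphism f -> conformal_automorphism g ->
  conformal_automorphism (g \o f).
Proof.
move=> [fh [f' [f'h fK f'K]]] [gh [g' [g'h gK g'K]]]; split.
  exact: disk_holomorphic_map_comp.
exists (f' \o g'); split; first exact: disk_holomorphic_map_comp.
- by case: fh => _ fc _ _ z zD /=; rewrite gK ?fK//; exact: fc.
- by case: g'h => _ gc _ _ z zD /=; rewrite f'K ?g'K//; exact: gc.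
Qed.

End conformal.

Section quotient.
Context (R : realType).
Local Open Scope quotient_scope.

Definition psl_equiv (phi psi : Diff1 R) : bool :=
  `[< exists2 g, PSL2R g & forall t, psi t = g (phi t) >].

Lemma psl_equiv_refl : reflexive psl_equiv.
Proof.
move=> phi; apply/asboolP; exists id => //.
by exists id => //; exact: conformal_automorphism_id.
Qed.

Lemma psl_equiv_sym_imp phi psi : psl_equiv phi psi -> psl_equiv psi phi.
Proof.
move=> /asboolP[g [f [fh [f' [f'h fK f'K]]] fg] gE]; apply/asboolP.
have [psi' [psiK psi'K _ _ _]] := diff1P psi.
exists (phi \o psi') => [|t /=]; last by rewrite psiK.
exists f'; first by split=> //; exists f.
move=> t /=; rewrite -{1}(psi'K t) gE -fg fK//.
exact: circle_exp_closed.
Qed.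

Lemma psl_equiv_sym : symmetric psl_equiv.
Proof. by move=> phi psi; apply/idP/idP; exact: psl_equiv_sym_imp. Qed.

Lemma psl_equiv_trans : transitive psl_equiv.
Proof.
move=> psi phi chi /asboolP[g1 [f1 f1h f1g] g1E] /asboolP[g2 [f2 f2h f2g] g2E].
apply/asboolP; exists (g2 \o g1) => [|t /=]; last by rewrite g2E g1E.
exists (f2 \o f1); first exact: conformal_automorphism_comp.
by move=> t /=; rewrite f1g f2g.
Qed.

Canonical psl_equivRel :=
  EquivRel psl_equiv psl_equiv_refl psl_equiv_sym psl_equiv_trans.

Definition Diff1_PSL := quotient_topology {eq_quot psl_equiv}.

End quotient.

Section observable.
Context {R : realType}.
Local Open Scope quotient_scope.

Definition observable (phi : circle R -> circle R) (s t : circle R) : R :=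
  pi * Num.sqrt (cderiv phi t * cderiv phi s) / sin (pi * arc_len (phi s) (phi t)).

Definition Hol_bound (alpha K : R) (phi : circle R -> circle R) :=
  forall s t, s != t ->
    `|observable phi s t - pi / sin (pi * arc_len s t)|
      <= K * cdist s t `^ (alpha - 1).

(* [observable] is invariant under postcomposition by PSL(2,R), so the choice
   of the representative [phi] of [q] is immaterial. *)
Definition Hol (alpha K : R) : set (Diff1_PSL R) :=
  [set q | exists2 phi : Diff1 R, \pi_(Diff1_PSL R) phi = q & Hol_bound alpha K phi].

End observable.

(* Main.v *)
Require Import Defs.
From mathcomp Require Import all_boot all_order all_algebra.
From mathcomp Require Import generic_quotient complex ring lra zify.
From mathcomp Require Import all_classical all_reals all_analysis.

(* Post-composing with an element of PSL(2,R), which leaves the observables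
   unchanged, every class in Hol has a representative phi fixing 0, 1/4 and
   1/2; let N be the set of these representatives.  Writing q and Q for the
   chords |sin(pi(x - y))| and |sin(pi(F x - F y))| of a lift F of phi with
   derivative f, the Hoelder bound gives
     |sqrt(f x f y) q - Q| <= C q^alpha Q.
   As f takes the value 1 inside each of the three arcs between the fixed
   points, this bounds f from above; a propagation argument bounds f from
   below, and comparing two nearby points with a third one shows that f is
   equicontinuous over N.  Hence along an ultrafilter on N the pointwise limits
   of F and f exist, are uniform, and define an element of N.  So N is compact,
   and Hol is its image under the quotient map. *)

Set Implicit Arguments.
Unset Strict Implicit.
Unset Printing Implicit Defensive.

Import Order.TTheory GRing.Theory Num.Theory.
Import numFieldNormedType.Exports.

Local Open Scope classical_set_scope.
Local Open Scope ring_scope.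

(** * Coordinates on the circle *)

(** Normalizing cannot be avoided: PSL(2,R) is not compact and preserves the Hoelder bound, so the
    diffeomorphisms satisfying it form a non-compact set. Three points suffice because real matrices
    of positive determinant, acting on the lines of R^2, move any positively ordered triple of the
    circle to any other. The obstacle is that the bound never isolates one derivative: for nearby x,
    y it only compares the product f x f y with (Q/q)^2. What helps is that the error is
    proportional to Q. For small q it can be absorbed, giving Q <= 2 sqrt(f x f y) q, so that one
    small value of f makes F flat on an interval of fixed length; this drives the lower bound.
    Equicontinuity then plays s and t against a common third point u, which costs a division by
    sqrt(f u), hence the lower bound comes before it. The same lower bound keeps the derivative of
    the limit positive, so that the limit is again a diffeomorphism. Ultrafilters replace the
    extraction of subsequences: bounded quantities converge along them, and every estimate is
    uniform over N, hence survives the limit. *)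

Section circle_coordinates.
Context {R : realType}.
Implicit Types (s t : circle R) (x y : R) (n : int).

Lemma to_circle_val t : to_circle (circle_val t) = t.
Proof.
apply: val_inj => /=; have /andP[t0 t1] := circle_valP t.
by rewrite (@Num.Theory.floor_def _ _ 0) ?subr0// add0r t0 t1.
Qed.

Lemma circle_val_to_circle x : exists n, circle_val (to_circle x) = x + n%:~R.
Proof. by exists (- Num.floor x); rewrite rmorphN. Qed.

Lemma to_circleDz x n : to_circle (x + n%:~R) = to_circle x.
Proof.
apply: val_inj => /=.
by rewrite floorDrz ?intr_int// rmorphD/= intrKfloor; lra.
Qed.

Lemma to_circleD1 x : to_circle (x + 1) = to_circle x.
Proof. exact: (to_circleDz x 1). Qed.

Lemma to_circle_eqP x y : to_circle x = to_circle y <-> exists n, y = x + n%:~R.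
Proof.
split=> [/(congr1 (@circle_val R)) /= h|[n ->]]; last by rewrite to_circleDz.
by exists (Num.floor y - Num.floor x); rewrite rmorphB/=; lra.
Qed.

Lemma arc_len_itv s t : 0 <= arc_len s t < 1.
Proof.
have /andP[? ?] := circle_valP s; have /andP[? ?] := circle_valP t.
by rewrite /arc_len; case: (leP (circle_val s)) => ?; apply/andP; split; lra.
Qed.

Lemma arc_lenE s t : exists n, arc_len s t = circle_val t - circle_val s + n%:~R.
Proof. by rewrite /arc_len; case: leP => _; [exists 0|exists 1]; rewrite ?addr0. Qed.

Lemma arc_len_to_circle x y : exists n, arc_len (to_circle x) (to_circle y) = y - x + n%:~R.
Proof.
have [n ->] := arc_lenE (to_circle x) (to_circle y).
have [p ->] := circle_val_to_circle x; have [q ->] := circle_val_to_circle y.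
by exists (q - p + n); rewrite !rmorphD/= rmorphN/=; lra.
Qed.

Lemma signed_arc_itv s t : - 2^-1 <= signed_arc s t < 2^-1.
Proof.
have /andP[? ?] := arc_len_itv s t.
by rewrite /signed_arc; case: ltP => ?; apply/andP; split; lra.
Qed.

Lemma signed_arcE s t : exists n, signed_arc s t = circle_val t - circle_val s + n%:~R.
Proof.
have [n e] := arc_lenE s t.
rewrite /signed_arc e; case: ltP => _; first by exists n.
by exists (n - 1); rewrite rmorphB/=; lra.
Qed.

Lemma signed_arc_to_circle x y : exists n, signed_arc (to_circle x) (to_circle y) = y - x + n%:~R.
Proof.
have [n ->] := signed_arcE (to_circle x) (to_circle y).
have [p ->] := circle_val_to_circle x; have [q ->] := circle_val_to_circle y.
by exists (q - p + n); rewrite !rmorphD/= rmorphN/=; lra.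
Qed.

Lemma int_lt1_eq0 n : -1 < n%:~R :> R -> n%:~R < 1 :> R -> n = 0.
Proof.
move=> h1 h2; have : -1 < n by rewrite -(ltr_int R).
have : n < 1 by rewrite -(ltr_int R).
lia.
Qed.

Lemma signed_arc_small x y : - 2^-1 <= y - x < 2^-1 ->
  signed_arc (to_circle x) (to_circle y) = y - x.
Proof.
move=> /andP[? ?]; have /andP[] := signed_arc_itv (to_circle x) (to_circle y).
have [n ->] := signed_arc_to_circle x y => ? ?.
by rewrite (@int_lt1_eq0 n) ?addr0//; lra.
Qed.

Lemma to_circle_signed_arc s t : to_circle (circle_val s + signed_arc s t) = t.
Proof.
have [n ->] := signed_arcE s t.
by rewrite addrA subrKC to_circleDz to_circle_val.
Qed.

Lemma cdist_signed_arc s t : cdist s t = `|signed_arc s t|.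
Proof.
have /andP[? ?] := arc_len_itv s t.
rewrite /cdist /signed_arc; case: (ltP (arc_len s t) 2^-1) => h.
  by rewrite ger0_norm ?min_l//; lra.
by rewrite ler0_norm ?min_r//; lra.
Qed.

Lemma cdist_to_circle_le x y : cdist (to_circle x) (to_circle y) <= `|x - y|.
Proof.
have /andP[? ?] := arc_len_itv (to_circle x) (to_circle y).
have [xy|xy] := ltP `|x - y| 2^-1.
  rewrite cdist_signed_arc signed_arc_small 1?distrC//.
  by move: xy; rewrite ltr_norml => /andP[? ?]; apply/andP; split; lra.
rewrite (le_trans _ xy)// /cdist ge_min.
by have [?|?] := leP (arc_len (to_circle x) (to_circle y)) 2^-1; apply/orP; [left|right]; lra.
Qed.

Lemma to_circle_dist_lift s t :
  exists2 x, t = to_circle x & `|x - circle_val s| = cdist s t.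
Proof.
exists (circle_val s + signed_arc s t); first by rewrite to_circle_signed_arc.
by rewrite cdist_signed_arc; congr `|_|; lra.
Qed.

Lemma cdist_gt0 s t : s != t -> 0 < cdist s t.
Proof. by move=> st; have := mdist_gt0 s t; rewrite st. Qed.

Lemma nbhs_circleP t (P : set (circle R)) :
  nbhs t P <-> exists2 e, 0 < e & forall s, cdist t s < e -> P s.
Proof.
split=> [/nbhs_ballP[e /= e0 H]|[e e0 H]]; [|apply/nbhs_ballP]; exists e => //.
Qed.

End circle_coordinates.

(** * Lifts to the real line *)

Section real_derivatives.
Context {R : realType}.
Implicit Types (F f : R -> R) (x y z l : R).

Lemma is_derive_continuous F x l : is_derive x 1 F l -> {for x, continuous F}.
Proof. by case=> + _ => /derivable1_diffP/differentiable_continuous. Qed.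

Lemma is_derive_translate F x l :
  is_derive x 1 F l <-> is_derive (0 : R) 1 (fun h => F (x + h)) l.
Proof.
rewrite (_ : (fun h => F (x + h)) = F \o shift x); last first.
  by apply/funext => h /=; rewrite addrC.
split=> dF.
  rewrite -[l]mulr1; apply: is_derive1_comp; last exact: is_derive_shift.
  by rewrite /= add0r.
rewrite -[l]mulr1 (_ : F = (F \o shift x) \o shift (- x)).
  apply: is_derive1_comp; last exact: is_derive_shift.
  by rewrite /= subrr.
by apply/funext => y /=; rewrite subrK.
Qed.

(** As [u] vanishes at 0, Caratheodory's slope function of [u] times [v] is a slope function of the
    product, so mere continuity of [v] suffices. It spares differentiating the normalizing lengths
    in [mx_circle_derive]. *)
Lemma is_derive_mulr_vanish (u v : R -> R) (l : R) : u 0 = 0 ->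
  is_derive (0 : R) 1 u l -> {for 0, continuous v} ->
  is_derive (0 : R) 1 (fun h => u h * v h) (l * v 0).
Proof.
move=> u0 /is_derive1_caratheodory [g [gE cg <-]] cv.
apply/is_derive1_caratheodory; exists (fun h => g h * v h); split=> //.
- move=> z; have := gE z; rewrite u0 mul0r !subr0 => ->; ring.
- by apply: cvgM.
Qed.

Lemma is_derive_gt0_sign F l : F 0 = 0 -> is_derive (0 : R) 1 F l -> 0 < l ->
  \forall h \near (0 : R), (0 < h -> 0 < F h) /\ (h < 0 -> F h < 0).
Proof.
move=> F0 [dF lE] l0.
have : (fun h => h^-1 *: ((F \o shift 0) (h *: 1) - F 0)) @ 0^' --> l.
  by rewrite -lE; exact: dF.
rewrite F0 => /cvgr_gt /(_ _ l0); rewrite near_withinE.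
apply: filterS => h /= h0; split=> hs.
  have := h0 (lt0r_neq0 hs).
  rewrite subr0 addr0 /GRing.scale /= mulr1 pmulr_rgt0 ?invr_gt0//.
have := h0 (ltr0_neq0 hs).
by rewrite subr0 addr0 /GRing.scale /= mulr1 nmulr_rgt0 ?invr_lt0.
Qed.

Lemma derive_MVT F f x y : (forall z, is_derive z 1 F (f z)) -> x < y ->
  exists2 z, x < z < y & F y - F x = f z * (y - x).
Proof.
move=> dF xy.
have [|z] := @MVT R F f x y xy (fun z _ => dF z).
  apply: continuous_subspaceT => z; exact: is_derive_continuous (dF z).
by rewrite in_itv/= => zxy e; exists z.
Qed.

Lemma derive_gt0_increasing F f : (forall z, is_derive z 1 F (f z)) ->
  (forall z, 0 < f z) -> {homo F : x y / x < y}.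
Proof.
move=> dF f0 x y xy; have [z _ e] := derive_MVT dF xy.
by rewrite -subr_gt0 e mulr_gt0// subr_gt0.
Qed.

Lemma shift1_shiftz F : (forall x, F (x + 1) = F x + 1) ->
  forall x (n : int), F (x + n%:~R) = F x + n%:~R.
Proof.
move=> F1 x n; elim/int_rect: n x => [|n IH|n IH] x; first by rewrite !addr0.
  by rewrite intS rmorphD/= addrCA addrC F1 IH; lra.
have := F1 (x - n.+1%:~R); rewrite (_ : x - n.+1%:~R + 1 = x - n%:~R).
  rewrite rmorphN/= -rmorphN IH => /(congr1 (fun y => y - 1)); rewrite addrK => <-.
  by rewrite !rmorphN/= intS rmorphD/=; lra.
by rewrite intS rmorphD/=; lra.
Qed.

End real_derivatives.

Section lifts.
Context {R : realType}.
Implicit Types (phi psi : circle R -> circle R) (s t : circle R) (F f : R -> R) (x y l : R).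

(** Continuity and [F (x + 1) = F x + 1] are left out on purpose: the angle functions of matrices,
    chosen pointwise, are lifts in this sense and may jump by integers. *)
Definition is_lift phi F := forall x, to_circle (F x) = phi (to_circle x).

Lemma in_chart0 phi t : in_chart phi t 0 = 0.
Proof.
by rewrite /in_chart addr0 to_circle_val /signed_arc /arc_len lexx subrr invr_gt0 ltr0n.
Qed.

Lemma in_chart_to_circle phi x h :
  in_chart phi (to_circle x) h = signed_arc (phi (to_circle x)) (phi (to_circle (x + h))).
Proof.
rewrite /in_chart; have [n ->] := circle_val_to_circle x.
by rewrite (_ : x + n%:~R + h = x + h + n%:~R) ?to_circleDz//; lra.
Qed.

Lemma in_chart_lift phi F x : is_lift phi F -> {for x, continuous F} ->
  \forall h \near (0 : R), F (x + h) - F x = in_chart phi (to_circle x) h.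
Proof.
move=> lF cF.
have : (fun h => F (x + h)) @ (0 : R) --> F x.
  have := @continuous_comp R R R (fun h => x + h) F 0.
  rewrite /prop_for /continuous_at /= addr0; apply => //.
  by rewrite -[X in _ --> X]addr0; apply: cvgD; [exact: cvg_cst|exact: cvg_id].
move/cvgr_dist_lt => /(_ 2^-1); rewrite invr_gt0 ltr0n => /(_ isT).
apply: filterS => h; rewrite in_chart_to_circle -!lF distrC ltr_norml => /andP[? ?].
by rewrite signed_arc_small//; apply/andP; split; lra.
Qed.

Lemma is_derive_in_chart phi F x l : is_lift phi F -> is_derive x 1 F l ->
  is_derive (0 : R) 1 (in_chart phi (to_circle x)) l.
Proof.
move=> lF dF; apply: (@near_eq_is_derive _ _ _ (fun h => F (x + h) - F x)).
- exact: in_chart_lift (is_derive_continuous dF).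
- have /is_derive_translate dF0 := dF.
  by apply: is_derive_eq; rewrite subr0.
Qed.

Lemma is_derive_cderiv phi t l : is_derive (0 : R) 1 (in_chart phi t) l ->
  cderiv phi t = l.
Proof. by case=> _ <-; rewrite /cderiv derive1E. Qed.

Lemma C1_is_derive phi t : C1 phi -> is_derive (0 : R) 1 (in_chart phi t) (cderiv phi t).
Proof. by move=> [dphi _]; rewrite /cderiv derive1E; exact/derivableP. Qed.

Lemma C1_continuous phi : C1 phi -> continuous phi.
Proof.
move=> C1phi t P /nbhs_circleP[e e0 H].
have := is_derive_continuous (C1_is_derive t C1phi).
rewrite /prop_for /continuous_at in_chart0 => /cvgr0_norm_lt /(_ _ e0) [d /= d0 Hd].
apply/nbhs_circleP; exists d => // s.
rewrite cdist_signed_arc => ts; apply: H.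
have := Hd (signed_arc t s); rewrite /= sub0r normrN => /(_ ts).
by rewrite /in_chart to_circle_signed_arc -cdist_signed_arc.
Qed.

Lemma continuous_on_circle (k : circle R -> R) f : (forall x, k (to_circle x) = f x) ->
  continuous f -> continuous k.
Proof.
move=> kE cf t; apply/(@cvgrPdist_lt _ _ _ (nbhs t)) => e e0.
have /cvgrPdist_lt /(_ _ e0) [d /= d0 Hd] := cf (circle_val t).
apply/nbhs_circleP; exists d => // s.
have [x -> <-] := to_circle_dist_lift t s; rewrite -{2}(to_circle_val t) !kE distrC.
exact: Hd.
Qed.

Lemma is_derive_C1 phi f : continuous f ->
  (forall x, is_derive (0 : R) 1 (in_chart phi (to_circle x)) (f x)) ->
  C1 phi /\ forall x, cderiv phi (to_circle x) = f x.
Proof.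
move=> cf dphi.
have cd x : cderiv phi (to_circle x) = f x by exact: is_derive_cderiv.
split=> //; split; last exact: continuous_on_circle cf.
by move=> t; rewrite -(to_circle_val t); have [] := dphi (circle_val t).
Qed.

Lemma lift_C1 phi F f : is_lift phi F -> (forall x, is_derive x 1 F (f x)) ->
  continuous f -> C1 phi /\ forall x, cderiv phi (to_circle x) = f x.
Proof. by move=> lF dF cf; apply: is_derive_C1 => // x; exact: is_derive_in_chart. Qed.

Lemma increasing_shift1_inverse F f : (forall x, F (x + 1) = F x + 1) ->
  (forall x, is_derive x 1 F (f x)) -> (forall x, 0 < f x) ->
  exists G, [/\ cancel F G, cancel G F, forall y, G (y + 1) = G y + 1
    & forall y, is_derive y 1 G (f (G y))^-1].
Proof.
move=> F1 dF f0.
have Finc := derive_gt0_increasing dF f0.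
have Finj : injective F.
  by move=> x y e; have [/Finc|/Finc|//] := ltgtP x y; rewrite e ltxx.
have Fcont : continuous F by move=> x; exact: is_derive_continuous (dF x).
have surj y : exists x, F x = y.
  (* [F] maps the integer [m] to [F 0 + m], so [y] lies between the values of [F] at [n] and
     [n + 1]. *)
  pose n : int := Num.floor (y - F 0).
  have /andP[nl nu] := floor_itv (y - F 0); rewrite -/n in nl nu.
  have FE (m : int) : F m%:~R = F 0 + m%:~R by rewrite -(shift1_shiftz F1) add0r.
  have [|||x _ <-] := @IVT R F n%:~R (n + 1)%:~R y; last by exists x.
  - by rewrite ler_int; lia.
  - exact: continuous_subspaceT.
  - by rewrite !FE ge_min le_max; apply/andP; split; apply/orP; [left|right]; lra.
have [G GF] := choice surj.
have FG : cancel F G by move=> x; apply: Finj; rewrite GF.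
exists G; split => //.
- by move=> y; apply: Finj; rewrite F1 !GF.
- move=> y; rewrite -{1}(GF y); apply: is_derive_inverse => //.
  + by near=> x; exact: FG.
  + by near=> x; exact: Fcont.
  + exact: lt0r_neq0.
Unshelve. all: by end_near. Qed.

Lemma is_lift_to_circle F : (forall x, F (x + 1) = F x + 1) ->
  is_lift (fun t => to_circle (F (circle_val t))) F.
Proof.
move=> F1 x; have [n ->] := circle_val_to_circle x.
by rewrite shift1_shiftz// to_circleDz.
Qed.

Lemma lift_oriented_C1_diffeo F f : (forall x, F (x + 1) = F x + 1) ->
  (forall x, is_derive x 1 F (f x)) -> continuous f -> (forall x, 0 < f x) ->
  oriented_C1_diffeo (fun t => to_circle (F (circle_val t))).
Proof.
move=> F1 dF cf f0.
have [G [FG GF G1 dG]] := increasing_shift1_inverse F1 dF f0.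
have lF := is_lift_to_circle F1; have lG := is_lift_to_circle G1.
have [C1F cd] := lift_C1 lF dF cf.
exists (fun t => to_circle (G (circle_val t))); split.
- by move=> t; rewrite -lG FG to_circle_val.
- by move=> t; rewrite -lF GF to_circle_val.
- exact: C1F.
- apply: (proj1 (lift_C1 lG dG _)) => y; apply: cvgV; first exact: lt0r_neq0.
  apply: continuous_comp; last exact: cf.
  exact: is_derive_continuous (dG y).
- by move=> t; rewrite -(to_circle_val t) cd.
Qed.

End lifts.

(** * Existence of a differentiable lift *)

Section lift_existence.
Context {R : realType}.
Implicit Types (phi psi : circle R -> circle R) (s t : circle R) (x y h : R).

Lemma arc_len_eq0 s t : arc_len s t = 0 -> s = t.
Proof.
move=> st; apply: (@cdist_eq0 R); rewrite /cdist st subr0 min_l//.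
Qed.

Lemma near_norm_lt (e : R) : 0 < e -> \forall h \near (0 : R), `|h| < e.
Proof. by move=> e0; exists e => // h /=; rewrite sub0r normrN. Qed.

Lemma floor_near x : x != (Num.floor x)%:~R ->
  \forall h \near (0 : R), Num.floor (x + h) = Num.floor x.
Proof.
have /andP[xl xu] := floor_itv x; rewrite rmorphD/= in xu => xn.
have {xl xn} xl : (Num.floor x)%:~R < x by rewrite lt_neqAle eq_sym xn.
near=> h; have : `|h| < Num.min (x - (Num.floor x)%:~R) ((Num.floor x)%:~R + 1 - x).
  by near: h; apply: near_norm_lt; rewrite lt_min; apply/andP; split; lra.
rewrite lt_min !ltr_norml => /andP[/andP[? ?] /andP[? ?]].
by apply: floor_def; rewrite rmorphD/=; apply/andP; split; lra.
Unshelve. all: by end_near. Qed.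

Lemma arc_len_in_chart phi s x h : exists n : int,
  arc_len s (phi (to_circle (x + h))) =
  arc_len s (phi (to_circle x)) + in_chart phi (to_circle x) h + n%:~R.
Proof.
rewrite in_chart_to_circle.
have [n1 ->] := arc_lenE s (phi (to_circle (x + h))).
have [n2 ->] := arc_lenE s (phi (to_circle x)).
have [n3 ->] := signed_arcE (phi (to_circle x)) (phi (to_circle (x + h))).
by exists (n1 - n2 - n3); rewrite !rmorphB/=; lra.
Qed.

(** The lift is explicit: the arc from [phi 0] to [phi x], plus [floor x]. The arc length drops from
    1 to 0 exactly when [x] crosses an integer, and the floor then rises by 1; the positive
    derivative makes the two jumps cancel rather than add. *)
Lemma oriented_C1_diffeo_lift phi : oriented_C1_diffeo phi ->
  exists F : R -> R, [/\ is_lift phi F, forall x, F (x + 1) = F x + 1,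
    forall x, is_derive x 1 F (cderiv phi (to_circle x))
    & F 0 = circle_val (phi (to_circle 0))].
Proof.
move=> [psi [phiK _ C1phi _ phi'_gt0]].
pose o : circle R := to_circle 0.
pose a x := arc_len (phi o) (phi (to_circle x)).
pose F x := (Num.floor x)%:~R + a x + circle_val (phi o).
have a_itv x : 0 <= a x < 1 by exact: arc_len_itv.
exists F; split.
- move=> x; rewrite /F /a; have [n ->] := arc_lenE (phi o) (phi (to_circle x)).
  rewrite [X in to_circle X](_ : _ = circle_val (phi (to_circle x)) + (Num.floor x + n)%:~R).
    by rewrite to_circleDz to_circle_val.
  by rewrite rmorphD/=; lra.
- move=> x; rewrite /F /a to_circleD1 floorDrz ?int_num1//.
  by rewrite rmorphD/= floor1; lra.
- move=> x; pose w h := in_chart phi (to_circle x) h.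
  have dw : is_derive (0 : R) 1 w (cderiv phi (to_circle x)) by exact: C1_is_derive.
  have w0 : w 0 = 0 by exact: in_chart0.
  have cw (e : R) : 0 < e -> \forall h \near (0 : R), `|w h| < e.
    move=> e0; have := is_derive_continuous dw.
    by rewrite /prop_for /continuous_at w0 => /cvgr0_norm_lt /(_ _ e0).
  (* It suffices that [F (x + h) = F x + w h] near 0. Both sides agree modulo integers, so each case
     below only has to show that the integer vanishes. *)
  apply/is_derive_translate.
  apply: (@near_eq_is_derive _ _ _ (fun h => F x + w h)); last first.
    rewrite -[cderiv _ _]add0r; apply: (@is_deriveD _ _ _ (cst (F x)) w).
  have [xo|xo] := pselect (to_circle x = o).
    have [m mx] : exists m : int, x = m%:~R.
      have /esym/to_circle_eqP[m ->] := xo; by exists m; rewrite add0r.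
    have ax : a x = 0 by rewrite /a xo /arc_len lexx subrr.
    near=> h.
    have h1 : `|h| < 1 by near: h; exact: near_norm_lt.
    have w1 : `|w h| < 1 by near: h; exact: cw.
    have [wp wn] : (0 < h -> 0 < w h) /\ (h < 0 -> w h < 0).
      by near: h; exact: is_derive_gt0_sign w0 dw (phi'_gt0 _).
    have [n an] := arc_len_in_chart phi (phi o) x h.
    rewrite -/(a (x + h)) -/(a x) -/(w h) ax add0r in an.
    have /andP[] := a_itv (x + h); rewrite an => ? ?.
    have fx : Num.floor x = m by rewrite mx intrKfloor.
    rewrite /F ax an fx; have [h0|h0] := ltP h 0.
      have fl : Num.floor (x + h) = m - 1.
        apply: floor_def; rewrite mx subrK rmorphB/=.
        by move: h1; rewrite ltr_norml => /andP[? ?]; apply/andP; split; lra.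
      have /int_lt1_eq0 n1 : -1 < (n - 1)%:~R :> R.
        by rewrite rmorphB/=; have := wn h0; lra.
      have {n1}-> : n = 1.
        apply/eqP; rewrite -subr_eq0; apply/eqP/n1; rewrite rmorphB/=.
        by move: w1; rewrite ltr_norml => /andP[? ?]; lra.
      by rewrite fl rmorphB/=; lra.
    have fl : Num.floor (x + h) = m.
      apply: floor_def; rewrite mx rmorphD/=.
      by move: h1; rewrite ltr_norml => /andP[? ?]; apply/andP; split; lra.
    have wh : 0 <= w h.
      move: h0; rewrite le_eqVlt => /orP[/eqP <-|/wp/ltW//]; by rewrite w0.
    move: w1; rewrite ltr_norml => /andP[? ?].
    by rewrite (@int_lt1_eq0 R n) ?fl; lra.
  (* Away from the integers, injectivity of [phi] keeps [a x] strictly inside (0,1), so a small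
     displacement cannot wrap around. *)
  have ax : 0 < a x.
    rewrite lt_neqAle; have /andP[-> _] := a_itv x; rewrite andbT eq_sym.
    by apply/eqP => /arc_len_eq0 /(can_inj phiK) /esym.
  near=> h.
  have -> : F x = (Num.floor (x + h))%:~R + a x + circle_val (phi o).
    rewrite /F; congr (_%:~R + _ + _); apply/esym; near: h; apply: floor_near.
    apply/eqP => xE; apply: xo; rewrite xE -[X in to_circle X]add0r.
    exact: to_circleDz.
  have : `|w h| < Num.min (a x) (1 - a x).
    near: h; apply: cw; have /andP[? ?] := a_itv x.
    by rewrite lt_min; apply/andP; split; lra.
  rewrite lt_min !ltr_norml => /andP[/andP[? ?] /andP[? ?]].
  have [n an] := arc_len_in_chart phi (phi o) x h.
  rewrite -/(a (x + h)) -/(a x) -/(w h) in an.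
  have /andP[] := a_itv (x + h); rewrite /F an => ? ?.
  by rewrite (@int_lt1_eq0 R n); lra.
- by rewrite /F floor0 /a /arc_len lexx subrr !add0r.
Unshelve. all: by end_near. Qed.

End lift_existence.

Section composition.
Context {R : realType}.
Implicit Types (phi psi : circle R -> circle R) (s t : circle R).

Lemma is_derive_in_chart_comp phi psi t : C1 phi -> C1 psi ->
  is_derive (0 : R) 1 (in_chart (psi \o phi) t) (cderiv psi (phi t) * cderiv phi t).
Proof.
move=> C1phi C1psi.
(* The charts compose exactly, for every [h]: adding [signed_arc] to its base point recovers the end
   point on the circle. *)
have -> : in_chart (psi \o phi) t = in_chart psi (phi t) \o in_chart phi t.
  by apply/funext => h; rewrite /= {2}/in_chart {1}/in_chart to_circle_signed_arc.
apply: is_derive1_comp; rewrite ?in_chart0; exact: C1_is_derive.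
Qed.

Lemma cderiv_comp phi psi t : C1 phi -> C1 psi ->
  cderiv (psi \o phi) t = cderiv psi (phi t) * cderiv phi t.
Proof. by move=> ? ?; exact/is_derive_cderiv/is_derive_in_chart_comp. Qed.

Lemma C1_comp phi psi : C1 phi -> C1 psi -> C1 (psi \o phi).
Proof.
move=> C1phi C1psi; split=> t; first by have [] := is_derive_in_chart_comp t C1phi C1psi.
rewrite (_ : cderiv _ = (cderiv psi \o phi) \* cderiv phi).
  apply: (@cvgM _ _ (nbhs t)); last exact: C1phi.2.
  by apply: continuous_comp; [exact: C1_continuous|exact: C1psi.2].
by apply/funext => s /=; rewrite cderiv_comp.
Qed.

Lemma oriented_C1_diffeo_comp phi psi : oriented_C1_diffeo phi ->
  oriented_C1_diffeo psi -> oriented_C1_diffeo (psi \o phi).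
Proof.
move=> [phi' [phiK phi'K C1phi C1phi' phi0]] [psi' [psiK psi'K C1psi C1psi' psi0]].
exists (phi' \o psi'); split.
- exact: can_comp.
- exact: can_comp.
- exact: C1_comp.
- exact: C1_comp.
- by move=> t; rewrite cderiv_comp// mulr_gt0.
Qed.

End composition.

(** * Sines of lifted differences *)

Section chords.
Context {R : realType}.
Implicit Types (x y : R) (n : int).

(** The sign (-1)^n is recorded only through [e * e = 1], common to sine and cosine; this is enough
    wherever absolute values or products of two such terms occur. *)
Lemma sin_cos_pi_shift x n : exists2 e : R, e * e = 1 &
  sin (pi * (x + n%:~R)) = e * sin (pi * x) /\ cos (pi * (x + n%:~R)) = e * cos (pi * x).
Proof.
have nat_shift (k : nat) y : exists2 e : R, e * e = 1 &
    sin (pi * (y + k%:R)) = e * sin (pi * y) /\ cos (pi * (y + k%:R)) = e * cos (pi * y).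
  elim: k => [|k [e e1 [sE cE]]]; first by exists 1; rewrite ?addr0 ?mul1r// mulr1.
  exists (- e); first by rewrite mulrNN.
  rewrite -natr1 (_ : pi * _ = pi * (y + k%:R) + pi); last by ring.
  by rewrite sinDpi cosDpi sE cE !mulNr.
case: n => k; first exact: nat_shift.
have [e e1] := nat_shift k.+1 (x + (Negz k)%:~R).
rewrite NegzE rmorphN/= subrK => -[sE cE].
by exists e => //; rewrite sE cE !mulrA e1 !mul1r.
Qed.

Lemma norm_eq1_of_sqr (e : R) : e * e = 1 -> `|e| = 1.
Proof.
move=> e1; have : `|e| * `|e| == 1 by rewrite -normrM e1 normr1.
by rewrite -expr2 sqrf_eq1 => /orP[/eqP//|/eqP e_neg]; have := normr_ge0 e; rewrite e_neg; lra.
Qed.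

Lemma norm_sin_pi_shift x n : `|sin (pi * (x + n%:~R))| = `|sin (pi * x)|.
Proof.
have [e /norm_eq1_of_sqr e1 [-> _]] := sin_cos_pi_shift x n.
by rewrite normrM e1 mul1r.
Qed.

(** The sine is nonnegative on arc lengths, and its absolute value forgets integer shifts. Hence the
    denominators of observables can be read off any lifts. *)
Lemma sin_arc_len x y :
  sin (pi * arc_len (to_circle x) (to_circle y)) = `|sin (pi * (x - y))|.
Proof.
have /andP[a0 a1] := arc_len_itv (to_circle x) (to_circle y).
rewrite -[LHS]ger0_norm; last first.
  apply: sin_ge0_pi; rewrite mulr_ge0 ?pi_ge0//=.
  by rewrite ler_piMr ?pi_ge0// ltW.
have [n ->] := arc_len_to_circle x y; rewrite norm_sin_pi_shift.
by rewrite -opprB mulrN sinN normrN.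
Qed.

End chords.

(** * Uniform estimates for normalized lifts *)

Section sine_estimates.
Context {R : realType}.
Implicit Types x y : R.

Lemma pi_lt4 : pi < 4 :> R.
Proof. by have := @pihalf_lt2 R; lra. Qed.

Lemma sin_lipschitz x y : `|sin x - sin y| <= `|x - y|.
Proof.
wlog xy : x y / x < y.
  move=> H; have [/H//|/H|->] := ltgtP x y; last by rewrite !subrr.
  by rewrite distrC (distrC x).
have [z _ e] := derive_MVT (@is_derive_sin R) xy.
by rewrite distrC e normrM (distrC x) ler_piMl// cos_max.
Qed.

Lemma cos_piquarter_sqr : cos (pi / 4) ^+ 2 = 2^-1 :> R.
Proof.
have := cos_mulr2n (pi / 4 : R); rewrite (_ : pi / 4 *+ 2 = pi / 2); last by field.
by rewrite cos_pihalf; lra.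
Qed.

Lemma ge_cos_piquarter_sin x : 0 <= x <= pi / 4 -> x * cos (pi / 4) <= sin x.
Proof.
move=> /andP[]; rewrite le_eqVlt => /orP[/eqP <-|x0 xpi]; first by rewrite mul0r sin0.
have [z /andP[z0 zx]] := derive_MVT (@is_derive_sin R) x0.
rewrite sin0 !subr0 mulrC => ->; rewrite ler_pM2l// ltW// ltr_cos ?in_itv/=.
- by lra.
- by apply/andP; split; lra.
- by apply/andP; split; lra.
Qed.

(** Double angle: with c = cos(pi/4), sin x = 2 sin(x/2) cos(x/2) >= 2 (c x/2) c, and c^2 = 1/2. A
    weak form of Jordan's inequality. *)
Lemma le_half_sin x : 0 <= x <= pi / 2 -> x / 2 <= sin x.
Proof.
move=> /andP[x0 xpi]; set c := cos (pi / 4 : R).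
have c0 : 0 <= c.
  by apply: cos_ge0_pihalf; have := @pi_gt0 R => ?; apply/andP; split; lra.
have h : 0 <= x / 2 <= pi / 4 by apply/andP; split; lra.
have -> : sin x = (cos (x / 2) * sin (x / 2)) *+ 2.
  by rewrite -sin_mulr2n; congr sin; field.
rewrite [leLHS](_ : _ = (c * (x / 2 * c)) *+ 2); last first.
  have : c ^+ 2 = 2^-1 by exact: cos_piquarter_sqr.
  by rewrite expr2 => e; rewrite mulrCA e; field.
rewrite lerMn2r/= ler_pM// ?mulr_ge0// ?divr_ge0//; last exact: ge_cos_piquarter_sin.
have [->//|ne] := eqVneq (x / 2) (pi / 4).
have /andP[? ?] := h.
rewrite ltW// /c ltr_cos ?in_itv/=.
- by rewrite lt_neqAle ne.
- by apply/andP; split; lra.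
- by apply/andP; split; lra.
Qed.

(** Half the Euclidean distance between e^{2 pi i x} and e^{2 pi i y}; periodic in both arguments,
    hence meaningful on lifts. *)
Definition chord x y : R := `|sin (pi * (x - y))|.

Lemma chord_ge0 x y : 0 <= chord x y. Proof. exact: normr_ge0. Qed.

Lemma chord_le1 x y : chord x y <= 1. Proof. exact: sin_max. Qed.

Lemma chord_lipschitz x y z : `|chord x z - chord y z| <= 4 * `|x - y|.
Proof.
apply: (le_trans (ler_dist_dist _ _)); apply: (le_trans (sin_lipschitz _ _)).
rewrite -mulrBr (_ : x - z - (y - z) = x - y); last by ring.
by rewrite normrM ger0_norm ?pi_ge0// ler_wpM2r// ltW// pi_lt4.
Qed.

Lemma chord_le x y : chord x y <= 4 * `|x - y|.
Proof.
have := chord_lipschitz x y y.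
by rewrite /chord subrr mulr0 sin0 normr0 subr0 normr_id.
Qed.

Lemma chord_ge_small x y : `|x - y| <= 2^-1 -> `|x - y| <= chord x y.
Proof.
move=> h; rewrite /chord.
have -> : `|sin (pi * (x - y))| = `|sin (pi * `|x - y|)|.
  by have [_|_] := ger0P (x - y) => //; rewrite mulrN sinN normrN.
apply: le_trans (ler_norm _); apply: le_trans (le_half_sin _).
  by have := @pi_ge2 R => pi2; rewrite -mulrA mulrC -mulrA; rewrite ler_peMr//; lra.
rewrite mulr_ge0 ?pi_ge0//=; have := @pi_gt0 R => p.
by rewrite ler_pM2l.
Qed.

Lemma chord_ge x y (e : R) : 0 <= e -> e <= `|x - y| -> `|x - y| <= 1 - e -> e <= chord x y.
Proof.
move=> e0 h1 h2; have [h|h] := leP `|x - y| 2^-1; first exact: le_trans (chord_ge_small h).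
have -> : chord x y = chord 1 `|x - y|.
  rewrite /chord -(norm_sin_pi_shift (x - y) 0) addr0.
  have [_|_] := ger0P (x - y).
    by rewrite -[in RHS]opprB mulrN sinN normrN -(norm_sin_pi_shift _ (-1)).
  by rewrite -(norm_sin_pi_shift _ 1)/=; congr `|sin (_ * _)|; lra.
have e1 : `|1 - `|x - y| | = 1 - `|x - y|.
  by rewrite ger0_norm// subr_ge0; apply: (le_trans h2); rewrite gerBl.
by apply: le_trans (chord_ge_small _); rewrite e1; lra.
Qed.

End sine_estimates.

(** * Derivative bounds and equicontinuity, uniform over normalized lifts *)

Section hoelder_lifts.
Context {R : realType}.
Variables (K a : R).
Hypotheses (K0 : 0 <= K) (a0 : 0 < a).
Implicit Types (F f : R -> R) (x y s t : R).

(* The last clause is [Hol_bound] multiplied through by both chords, up to the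
   value of the constant, so that it also makes sense for [x = y]. *)
Definition hoelder_lift F f := [/\
  forall x, F (x + 1) = F x + 1, forall x, f (x + 1) = f x,
  forall x, is_derive x 1 F (f x), forall x, 0 < f x &
  forall x y, `|Num.sqrt (f x) * Num.sqrt (f y) * chord x y - chord (F x) (F y)|
              <= K * chord x y `^ a * chord (F x) (F y)].

Definition fixes_quarters F := [/\ F 0 = 0, F (1 / 4) = 1 / 4 & F (1 / 2) = 1 / 2].

Definition normalized_lift F f := hoelder_lift F f /\ fixes_quarters F.

Lemma powR_small (e : R) : 0 < e ->
  exists2 r : R, 0 < r & forall q, 0 <= q <= r -> K * q `^ a <= e.
Proof.
move=> e0; have K1 : 0 < K + 1 by have := K0; lra.
(* The solution of (K + 1) r^a = e; [K + 1] replaces [K], which may be 0. *)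
exists ((e / (K + 1)) `^ a^-1); first by apply: powR_gt0; exact: divr_gt0.
move=> q /andP[q0 qr].
have qa : q `^ a <= e / (K + 1).
  have -> : e / (K + 1) = ((e / (K + 1)) `^ a^-1) `^ a.
    by rewrite -powRrM mulVf ?lt0r_neq0// powRr1// divr_ge0// ltW.
  by apply: ge0_ler_powR; rewrite ?nnegrE ?powR_ge0// ltW.
apply: (le_trans (ler_wpM2l K0 qa)).
by rewrite mulrCA ger_pMr// ler_pdivrMr// mul1r; lra.
Qed.

(** At a reference point [y] with [f y = 1] and chord at least 1/8 from [x], the bound reads sqrt(f
    x) / 8 <= 1 + K. *)
Let M := ((1 + K) * 8) ^+ 2.

Lemma hoelder_lift_chord_le F f x y : hoelder_lift F f ->
  Num.sqrt (f x) * Num.sqrt (f y) * chord x y <= 1 + K.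
Proof.
move=> [_ _ _ _ /(_ x y)]; set X := _ * chord x y.
have Q1 := chord_le1 (F x) (F y); have Q0 := chord_ge0 (F x) (F y).
have qa1 : chord x y `^ a <= 1.
  rewrite [leRHS](_ : 1 = 1 `^ a); last by rewrite powR1.
  by apply: ge0_ler_powR; rewrite ?nnegrE ?chord_ge0 ?chord_le1// ltW.
have : K * chord x y `^ a * chord (F x) (F y) <= K.
  by rewrite -mulrA ler_piMr// mulr_ile1// powR_ge0.
by rewrite ler_norml => ? /andP[? ?]; lra.
Qed.

Lemma hoelder_lift_periodic F f x (n : int) : hoelder_lift F f -> f (x + n%:~R) = f x.
Proof.
move=> [_ f1 _ _ _]; elim/int_rect: n x => [|n IH|n IH] x; first by rewrite addr0.
  by rewrite intS rmorphD/= addrCA addrC f1.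
by rewrite -(IH x) intS opprD rmorphD/= -f1; congr f; lra.
Qed.

Lemma hoelder_lift_deriv_le F f x y : hoelder_lift F f -> f y = 1 ->
  8^-1 <= `|x - y| <= 7 / 8 -> f x <= M.
Proof.
move=> HF fy /andP[h1 h2]; have [_ _ _ f0 _] := HF.
have := hoelder_lift_chord_le x y HF; rewrite fy sqrtr1 mulr1.
have q8 : 8^-1 <= chord x y by apply: chord_ge => //; lra.
move=> h; rewrite -[f x](sqr_sqrtr (ltW (f0 _))).
apply: lerXn2r; rewrite ?nnegrE ?sqrtr_ge0 ?mulr_ge0 ?addr_ge0//.
rewrite -ler_pdivrMr//; apply: le_trans h.
by rewrite ler_wpM2l ?sqrtr_ge0.
Qed.

Lemma normalized_lift_deriv_le F f x : normalized_lift F f -> f x <= M.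
Proof.
move=> [HF [F0 F4 F2]].
have [n xn] : exists n : int, 0 <= x + n%:~R < 1.
  by exists (- Num.floor x); rewrite rmorphN; have := @to_circle_subproof R x.
rewrite -(hoelder_lift_periodic x n HF); move: (x + _) xn => {n}{}x /andP[x0 x1].
have [F1 _ dF _ _] := HF.
have F1E : F 1 = 1 by rewrite -[X in F X]add0r F1 F0 add0r.
have [y1 /andP[? ?] e1] : exists2 y, 0 < y < 1 / 4 & f y = 1.
  by have [|y ? e] := derive_MVT dF (_ : 0 < 1 / 4); first lra; exists y => //; lra.
have [y2 /andP[? ?] e2] : exists2 y, 1 / 4 < y < 1 / 2 & f y = 1.
  by have [|y ? e] := derive_MVT dF (_ : 1 / 4 < 1 / 2); first lra; exists y => //; lra.
have [y3 /andP[? ?] e3] : exists2 y, 1 / 2 < y < 1 & f y = 1.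
  by have [|y ? e] := derive_MVT dF (_ : 1 / 2 < 1); first lra; exists y => //; lra.
(* In each case the reference point is chosen at distance between 1/8 and 7/8 from [x], that is, at
   least 1/8 away on the circle. *)
have [?|?] := leP x (1 / 8).
  apply: (hoelder_lift_deriv_le HF e2); rewrite ler0_norm; last lra.
  by apply/andP; split; lra.
have [?|?] := leP x (3 / 8).
  apply: (hoelder_lift_deriv_le HF e3); rewrite ler0_norm; last lra.
  by apply/andP; split; lra.
have [?|?] := leP x (3 / 4).
  apply: (hoelder_lift_deriv_le HF e1); rewrite ger0_norm; last lra.
  by apply/andP; split; lra.
apply: (hoelder_lift_deriv_le HF e2); rewrite ger0_norm; last lra.
by apply/andP; split; lra.
Qed.

Lemma normalized_lift_lipschitz F f x y : normalized_lift F f ->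
  `|F x - F y| <= M * `|x - y|.
Proof.
move=> NF; wlog xy : x y / x < y.
  move=> H; have [/H//|/H|->] := ltgtP x y; last by rewrite !subrr normr0 mulr0.
  by rewrite distrC (distrC x).
have [[_ _ dF f0 _] _] := NF; have [z _ e] := derive_MVT dF xy.
rewrite distrC e normrM (distrC x) ler_wpM2r// ger0_norm ?(ltW (f0 _))//.
exact: normalized_lift_deriv_le NF.
Qed.

Let M_gt0 : 0 < M.
Proof. have K0' : 0 <= K := K0; rewrite /M exprn_gt0// mulr_gt0//; lra. Qed.

(** Once K q^a <= 1/2, the error term is absorbed and Q <= 2 sqrt(f s f t) q. Bounding [f t] by [M]
    leaves a factor sqrt(f s): smallness of [f] at the single point [s] spreads to a neighbourhood
    whose size [d] depends on neither [F] nor [s]. *)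
Lemma normalized_lift_flat : exists2 d : R, 0 < d &
  forall F f s t, normalized_lift F f -> `|s - t| <= d ->
    `|F s - F t| <= 8 * Num.sqrt M * Num.sqrt (f s) * `|s - t|.
Proof.
have [|r r0 Hr] := @powR_small 2^-1; first by rewrite invr_gt0.
(* The first bound gives a chord of at most [r]; the second keeps [F s] and [F t] within 1/2, where
   the chord dominates the distance. *)
exists (Num.min (r / 4) (2^-1 / M)).
  by rewrite lt_min !divr_gt0.
move=> F f s t NF; rewrite le_min => /andP[h1 h2].
have [[_ _ _ f0 /(_ s t) H] _] := NF.
have q0 := chord_ge0 s t; have Q0 := chord_ge0 (F s) (F t).
have q4 := chord_le s t.
have : K * chord s t `^ a <= 2^-1 by apply: Hr; apply/andP; split=> //; lra.
move=> Kq; have {Kq} : K * chord s t `^ a * chord (F s) (F t) <= 2^-1 * chord (F s) (F t).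
  exact: ler_wpM2r.
have FQ : `|F s - F t| <= chord (F s) (F t).
  apply: chord_ge_small; apply: (le_trans (normalized_lift_lipschitz s t NF)).
  by rewrite mulrC -ler_pdivlMr.
have : Num.sqrt (f s) * Num.sqrt (f t) * chord s t
    <= Num.sqrt (f s) * Num.sqrt M * (4 * `|s - t|).
  apply: ler_pM; [by rewrite mulr_ge0 ?sqrtr_ge0|by []| |by []].
  rewrite ler_wpM2l ?sqrtr_ge0// ler_wsqrtr//.
  exact: normalized_lift_deriv_le NF.
move: H; rewrite ler_norml => /andP[? ?] ? ?; lra.
Qed.

(* If [f s] is small, then [F] is flat near [s] and the mean value theorem
   yields another point with small [f], further right by at least [d / 2].
   After about [2 / d] such steps, [F] is almost constant over a whole period. *)
Lemma normalized_lift_deriv_ge : exists2 m : R, 0 < m &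
  forall F f s, normalized_lift F f -> m <= f s.
Proof.
have [d d0 flat] := normalized_lift_flat.
have [C CE] : exists C, C = 8 * Num.sqrt M by eexists.
have C0 : 0 < C by rewrite CE mulr_gt0// sqrtr_gt0.
rewrite -CE in flat.
have chain (n : nat) (e : R) : 0 < e -> exists2 m : R, 0 < m &
    forall F f s, normalized_lift F f -> f s <= m -> F (s + n%:R * (d / 2)) - F s <= e.
  elim: n e => [|n IH] e e0; first by exists 1 => // *; rewrite mul0r addr0 subrr ltW.
  have [|m1 m10 H] := IH (e / 2); first by rewrite divr_gt0.
  (* With sqrt(f s) <= k, the first term bounds the increment of [F] over [s, s + d] by e/2. The
     second makes the mean value [f t] on the right half, at most 2 C k, small enough for the
     induction hypothesis at [t]. *)
  pose k := Num.min (e / 2 / (C * d)) (m1 / (2 * C)).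
  have k0 : 0 < k by rewrite lt_min !divr_gt0// mulr_gt0.
  exists (k ^+ 2); first by rewrite exprn_gt0.
  move=> F f s NF fs.
  have [[_ _ dF f0 _] _] := NF; have Finc := derive_gt0_increasing dF f0.
  have fsk : Num.sqrt (f s) <= k.
    by rewrite -[leRHS]gtr0_norm// -sqrtr_sqr ler_wsqrtr.
  have step : F (s + d) - F s <= C * k * d.
    have := flat F f s (s + d) NF; rewrite opprD addrA subrr sub0r normrN gtr0_norm// lexx.
    move=> /(_ isT); rewrite distrC => /(le_trans (ler_norm _)) /le_trans; apply.
    by rewrite ler_pM2r// ler_pM2l.
  have [|t /andP[t1 t2] ft] := derive_MVT dF (_ : s + d / 2 < s + d); first lra.
  have Fs : F s < F (s + d / 2) by apply: Finc; lra.
  have Ft : F t < F (s + d) by exact: Finc.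
  have ke : C * k * d <= e / 2.
    have : k <= e / 2 / (C * d) by rewrite ge_min lexx.
    by rewrite ler_pdivlMr ?mulr_gt0// => h; lra.
  have km : 2 * C * k <= m1.
    have : k <= m1 / (2 * C) by rewrite ge_min lexx orbT.
    by rewrite ler_pdivlMr ?mulr_gt0// => h; lra.
  have ftm : f t <= m1.
    have : f t * (d / 2) <= m1 * (d / 2).
      have : 2 * C * k * (d / 2) <= m1 * (d / 2) by rewrite ler_pM2r ?divr_gt0.
      lra.
    by rewrite ler_pM2r ?divr_gt0.
  have := H F f t NF ftm.
  have : F (s + n.+1%:R * (d / 2)) < F (t + n%:R * (d / 2)).
    by apply: Finc; rewrite -natr1; lra.
  lra.
pose n := (Num.truncn (2 / d)).+1.
have [|m m0 H] := chain n 2^-1; first by rewrite invr_gt0.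
exists m => // F f s NF; rewrite leNgt; apply/negP => /ltW fs.
have := H F f s NF fs; have [[F1 _ dF f0 _] _] := NF.
have : F (s + 1) <= F (s + n%:R * (d / 2)).
  apply/ltW/(derive_gt0_increasing dF f0); rewrite ltrD2l.
  have : 2 / d < n%:R by rewrite truncnS_gt// divr_ge0// ltW.
  by rewrite ltr_pdivrMr//; lra.
by rewrite F1; lra.
Qed.

(* The Hoelder bound for the pairs [(s, u)] and [(t, u)], where [u] is at
   distance [r] from [s], compares [f s] with [f t]: the error is of order
   [r `^ a] plus [`|s - t| / r]. *)
Lemma normalized_lift_equicontinuous (e : R) : 0 < e -> exists2 d : R, 0 < d &
  forall F f s t, normalized_lift F f -> `|s - t| <= d -> `|f s - f t| <= e.
Proof.
move=> e0; have [m m0 f_ge] := normalized_lift_deriv_ge.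
have sM0 : 0 < Num.sqrt M by rewrite sqrtr_gt0.
have sm0 : 0 < Num.sqrt m by rewrite sqrtr_gt0.
(* Chosen so that the total error 8 M r (e / c), divided by sqrt(m) r, equals e / (2 sqrt M); the
   factor sqrt(f s) + sqrt(f t) <= 2 sqrt M then restores e. *)
have [c cE c0] : exists2 c, c = 16 * M * Num.sqrt M / Num.sqrt m & 0 < c.
  by eexists => //; apply: divr_gt0 => //; apply: mulr_gt0 => //; exact: mulr_gt0.
have [|r1 r10 Hr] := @powR_small (e / (4 * c)); first by rewrite divr_gt0// mulr_gt0.
(* The 8 arises because a chord is at most 4 times a distance which is itself at most 2 r;
   [r <= 1/4] keeps [u] within 1/2 of [s]. *)
have [r [r0 r14 r18]] : exists r : R, [/\ 0 < r, r <= 4^-1 & r <= r1 / 8].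
  exists (Num.min (r1 / 8) 4^-1); split; rewrite ?ge_min ?lexx ?orbT//.
  by rewrite lt_min divr_gt0//= invr_gt0.
exists (r * Num.min 1 (e / (2 * c))).
  by rewrite mulr_gt0// lt_min ltr01 divr_gt0// mulr_gt0.
move=> F f s t NF; rewrite -ler_pdivrMl// le_min => /andP[st1 st2].
have st : `|s - t| <= r by move: st1; rewrite ler_pdivrMl// mulr1.
have stc : `|s - t| * c <= r * (e / 2).
  move: st2; rewrite ler_pdivrMl// => st2.
  rewrite -ler_pdivlMr//; apply: (le_trans st2).
  by rewrite le_eqVlt; apply/orP; left; apply/eqP; field; exact: lt0r_neq0.
pose u := s + r.
have su : `|s - u| = r by rewrite /u opprD addrA subrr sub0r normrN gtr0_norm.
have tu : `|t - u| <= 2 * r.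
  apply: (le_trans (ler_distD s _ _)); rewrite su distrC; lra.
have q1r : r <= chord s u by rewrite -su chord_ge_small// su; lra.
have q2r := chord_le t u; have q1r' := chord_le s u.
have [[_ _ _ f0 H] _] := NF.
have Kq x : `|x - u| <= 2 * r ->
    K * chord x u `^ a * chord (F x) (F u) <= e / (4 * c) * (8 * M * r).
  move=> xu; apply: ler_pM; rewrite ?mulr_ge0 ?powR_ge0 ?chord_ge0//.
    by apply: Hr; rewrite chord_ge0/=; have := chord_le x u; lra.
  apply: (le_trans (chord_le _ _)).
  have := normalized_lift_lipschitz x u NF => h.
  have : M * `|x - u| <= M * (2 * r) by rewrite ler_pM2l.
  lra.
have {Kq} [H1 H2] : `|Num.sqrt (f s) * Num.sqrt (f u) * chord s u - chord (F s) (F u)|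
      <= e / (4 * c) * (8 * M * r) /\
    `|Num.sqrt (f t) * Num.sqrt (f u) * chord t u - chord (F t) (F u)|
      <= e / (4 * c) * (8 * M * r).
  split; [apply: le_trans (H s u) (Kq s _)|apply: le_trans (H t u) (Kq t tu)].
  by rewrite su; lra.
have QQ : `|chord (F s) (F u) - chord (F t) (F u)| <= 4 * (M * `|s - t|).
  apply: (le_trans (chord_lipschitz _ _ _)); rewrite ler_pM2l//.
  exact: normalized_lift_lipschitz NF.
have sqM x : Num.sqrt (f x) <= Num.sqrt M.
  by rewrite ler_wsqrtr//; exact: normalized_lift_deriv_le NF.
have qq : `|Num.sqrt (f t) * Num.sqrt (f u) * (chord s u - chord t u)| <= M * (4 * `|s - t|).
  rewrite normrM; apply: ler_pM => //; last exact: chord_lipschitz.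
  rewrite ger0_norm ?mulr_ge0 ?sqrtr_ge0// -[leRHS](sqr_sqrtr (ltW M_gt0)).
  by rewrite expr2 ler_pM ?sqrtr_ge0.
(* Four errors of at most 2 M r (e / c) each: the two Hoelder bounds, the change of the image chord
   and the change of the source chord when [s] is replaced by [t]. *)
have key : Num.sqrt m * r * `|Num.sqrt (f s) - Num.sqrt (f t)| <= 8 * M * r * (e / c).
  apply: (@le_trans _ _ (Num.sqrt (f u) * chord s u * `|Num.sqrt (f s) - Num.sqrt (f t)|)).
    rewrite ler_wpM2r// ler_pM ?sqrtr_ge0 ?(ltW r0)//.
    by rewrite ler_wsqrtr//; exact: f_ge NF.
  have -> : Num.sqrt (f u) * chord s u * `|Num.sqrt (f s) - Num.sqrt (f t)| =
      `|Num.sqrt (f s) * Num.sqrt (f u) * chord s u - Num.sqrt (f t) * Num.sqrt (f u) * chord s u|.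
    rewrite -!mulrBl normrM (normrM (_ - _)) (ger0_norm (chord_ge0 _ _)).
    by rewrite (ger0_norm (sqrtr_ge0 _)); ring.
  have e4c : e / (4 * c) = e / c / 4 by field; exact: lt0r_neq0.
  have : M * `|s - t| <= M * (r * (e / c / 2)).
    rewrite ler_pM2l// -(ler_pM2r c0); apply: (le_trans stc).
    by rewrite le_eqVlt; apply/orP; left; apply/eqP; field; exact: lt0r_neq0.
  move: H1 H2 QQ qq; rewrite e4c !ler_norml.
  move=> /andP[? ?] /andP[? ?] /andP[? ?] /andP[? ?] ?.
  by apply/andP; split; lra.
have {key}key : `|Num.sqrt (f s) - Num.sqrt (f t)| <= e / (2 * Num.sqrt M).
  have ce : 8 * M * r * (e / c) = Num.sqrt m * r * (e / (2 * Num.sqrt M)).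
    by rewrite cE; field; rewrite !lt0r_neq0.
  by move: key; rewrite ce ler_pM2l// mulr_gt0.
have -> : f s - f t = (Num.sqrt (f s) - Num.sqrt (f t)) * (Num.sqrt (f s) + Num.sqrt (f t)).
  by rewrite -subr_sqr !sqr_sqrtr ?(ltW (f0 _)).
rewrite normrM [leRHS](_ : e = e / (2 * Num.sqrt M) * (2 * Num.sqrt M)); last first.
  by field; exact: lt0r_neq0.
apply: ler_pM => //; rewrite ger0_norm ?addr_ge0 ?sqrtr_ge0//.
by have := sqM s; have := sqM t; lra.
Qed.

End hoelder_lifts.

(** * Moebius transformations *)

Section disk_moebius.
Context {C : numClosedFieldType}.
Implicit Types a b z : C.

(** The action of the matrix with rows (a, b) and (conj b, conj a). For |b| < |a| it lies in SU(1,1)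
    up to a positive scalar; the determinant is not normalized. *)
Definition moebius a b z := (a * z + b) / (b^* * z + a^*).

(** For |b| < |a| the comparison of numerator and denominator has the sign of 1 - |z|^2, so the open
    and the closed disk are both preserved. *)
Lemma moebius_norm a b z :
  `|b^* * z + a^*| ^+ 2 - `|a * z + b| ^+ 2 = (`|a| ^+ 2 - `|b| ^+ 2) * (1 - `|z| ^+ 2).
Proof. by rewrite !normCK !rmorphD !rmorphM/= !conjCK; ring. Qed.

Lemma moebius_denom_neq0 a b z : `|b| < `|a| -> `|z| <= 1 -> b^* * z + a^* != 0.
Proof.
move=> ba z1; apply: contraTneq ba => /eqP; rewrite addr_eq0 => /eqP baz.
have : `|b^* * z| = `|a| by rewrite baz normrN norm_conjC.
rewrite normrM norm_conjC => <-; rewrite -real_leNgt ?rpredM ?normr_real//.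
by rewrite ler_piMr.
Qed.

Lemma moebius_lt1 a b z : `|b| < `|a| -> `|z| < 1 -> `|moebius a b z| < 1.
Proof.
move=> ba z1; have d0 := moebius_denom_neq0 ba (ltW z1).
rewrite normrM normfV ltr_pdivrMr ?normr_gt0// mul1r -ltr_sqr ?nnegrE//.
rewrite -subr_gt0 moebius_norm mulr_gt0// subr_gt0 ?ltr_sqr ?nnegrE//.
by rewrite expr_lt1.
Qed.

Lemma moebius_le1 a b z : `|b| < `|a| -> `|z| <= 1 -> `|moebius a b z| <= 1.
Proof.
move=> ba z1; have d0 := moebius_denom_neq0 ba z1.
rewrite normrM normfV ler_pdivrMr ?normr_gt0// mul1r -ler_sqr ?nnegrE//.
rewrite -subr_ge0 moebius_norm mulr_ge0// subr_ge0 ?ler_sqr ?nnegrE ?(ltW ba)//.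
by rewrite expr_le1.
Qed.

Lemma moebiusK a b z : `|b| < `|a| -> `|z| <= 1 -> moebius a^* (- b) (moebius a b z) = z.
Proof.
move=> ba z1; have d0 := moebius_denom_neq0 ba z1.
have ab0 : a * a^* - b * b^* != 0.
  by rewrite -!normCK subr_eq0 gt_eqF// ltr_sqr ?nnegrE.
have e0 : a * (b^* * z + a^*) - b^* * (a * z + b) != 0.
  by rewrite (_ : _ - _ = a * a^* - b * b^*)//; ring.
rewrite /moebius rmorphN conjCK; field; rewrite d0 /=.
by apply: contra e0 => /eqP e0; apply/eqP; rewrite -[RHS]e0; ring.
Qed.

End disk_moebius.

Section disk_moebius_analysis.
Context {R : realType}.
Local Notation C := (Cplx R).

Lemma moebius_continuous (a b z : C) : `|b| < `|a| -> `|z| <= 1 ->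
  {for z, continuous (moebius a b)}.
Proof.
move=> ba z1.
have affine (c d : C) : {for z, continuous (fun w : C => c * w + d)}.
  by apply: (@cvgD _ _ _ (nbhs z)); [exact: mulrl_continuous|exact: cvg_cst].
apply: (@cvgM _ _ (nbhs z)); first exact: affine.
by apply: (@cvgV _ _ (nbhs z)); [exact: moebius_denom_neq0|exact: affine].
Qed.

Lemma moebius_derivable (a b z : C) : `|b| < `|a| -> `|z| <= 1 ->
  derivable (moebius a b) z 1.
Proof.
move=> ba z1; apply: derivableM; first by apply: derivableD => //; apply: derivableM.
apply: derivableV; first exact: moebius_denom_neq0.
by apply: derivableD => //; apply: derivableM.
Qed.

Lemma moebius_holomorphic (a b : C) : `|b| < `|a| -> disk_holomorphic_map (moebius a b).
Proof.
move=> ba; split.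
- by move=> z; exact: moebius_lt1.
- by move=> z; exact: moebius_le1.
- by move=> z /ltW; exact: moebius_derivable.
- apply/subspace_continuousP => z zD.
  by apply: cvg_within_filter; exact: moebius_continuous.
Qed.

Lemma moebius_automorphism (a b : C) : `|b| < `|a| -> conformal_automorphism (moebius a b).
Proof.
move=> ba; have ba' : `|- b| < `|a^*| by rewrite normrN norm_conjC.
split; first exact: moebius_holomorphic.
exists (moebius a^* (- b)); split; first exact: moebius_holomorphic.
- by move=> z; exact: moebiusK.
- by move=> z /(moebiusK ba'); rewrite conjCK opprK.
Qed.

End disk_moebius_analysis.

(** * The projective action of real matrices on the circle *)

Section circle_moebius.
Context {R : realType}.
Implicit Types (x y h : R).

Lemma sin_pi_eq0_int x : sin (pi * x) = 0 -> exists n : int, x = n%:~R.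
Proof.
move=> sx; exists (Num.floor x); apply/eqP; rewrite eq_sym eq_le floor_le/= leNgt.
apply/negP => xl; have /andP[_ xu] := floor_itv x; rewrite rmorphD/= in xu.
have := norm_sin_pi_shift x (- Num.floor x); rewrite sx normr0 => /eqP.
rewrite normr_eq0 gt_eqF//; apply: sin_gt0_pi; rewrite rmorphN/=; apply/andP; split.
  by rewrite mulr_gt0 ?pi_gt0//; lra.
by rewrite gtr_pMr ?pi_gt0//; lra.
Qed.

Lemma polar_coordinates (u v : R) : 0 < u ^+ 2 + v ^+ 2 ->
  exists th, cos (pi * th) * Num.sqrt (u ^+ 2 + v ^+ 2) = u /\
             sin (pi * th) * Num.sqrt (u ^+ 2 + v ^+ 2) = v.
Proof.
set N := _ + _ => N0; have D0 : 0 < Num.sqrt N by rewrite sqrtr_gt0.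
have DD : Num.sqrt N ^+ 2 = N by rewrite sqr_sqrtr// ltW.
set D := Num.sqrt N in D0 DD *.
have uv1 : (u / D) ^+ 2 + (v / D) ^+ 2 = 1.
  by rewrite !expr_div_n -mulrDl DD divff// lt0r_neq0.
have uD : -1 <= u / D <= 1.
  have : (u / D) ^+ 2 <= 1 by rewrite -uv1 lerDl sqr_ge0.
  by rewrite -[(u / D) ^+ 2]real_normK ?num_real// expr_le1// ler_norml.
pose th := acos (u / D) / pi.
have pi0 : pi != 0 :> R by rewrite lt0r_neq0// pi_gt0.
have pth : pi * th = acos (u / D) by rewrite /th mulrCA mulfV ?mulr1.
have ct : cos (pi * th) = u / D by rewrite pth acosK// in_itv.
have st : sin (pi * th) = `|v / D|.
  rewrite pth sin_acos// (_ : 1 - _ = (v / D) ^+ 2) ?sqrtr_sqr//.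
  by rewrite -uv1 addrC addKr.
have [v0|v0] := leP 0 v.
  exists th; rewrite ct st ger0_norm ?divr_ge0 ?(ltW D0)//.
  by rewrite !divfK ?lt0r_neq0.
exists (- th); rewrite mulrN cosN sinN ct st ler0_norm ?opprK.
  by rewrite !divfK ?lt0r_neq0.
by rewrite ltW// ltr_pdivrMr ?mul0r.
Qed.

(** The point [x] of the circle stands for the line of R^2 at angle pi x, since lines repeat modulo
    pi. [mxX p q x] and [mxX r s x] are the two coordinates of the image of its unit vector under
    the matrix with rows (p, q) and (r, s). *)
Definition mxX (p q x : R) := p * cos (pi * x) + q * sin (pi * x).

Lemma continuous_mxX p q : continuous (mxX p q).
Proof.
move=> x; have cpi : {for x, continuous (fun y : R => pi * y)} by exact: mulrl_continuous.
have cc : {for x, continuous (fun y : R => cos (pi * y))}.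
  by apply: continuous_comp; [exact: cpi|exact: continuous_cos].
have cs : {for x, continuous (fun y : R => sin (pi * y))}.
  by apply: continuous_comp; [exact: cpi|exact: continuous_sin].
by apply: cvgD; apply: cvgM => //; exact: cvg_cst.
Qed.

Variables (p q r s : R).
Let dt := p * s - q * r.
Hypothesis dt_gt0 : 0 < dt.

Let X := mxX p q.
Let Y := mxX r s.
Definition mxN x := mxX p q x ^+ 2 + mxX r s x ^+ 2.
Let N := mxN.
Let D x := Num.sqrt (N x).

(** A matrix multiplies the cross product of two vectors by its determinant. After division by the
    lengths this is the transformation rule for chords. *)
Lemma mx_sin x y : Y x * X y - X x * Y y = dt * sin (pi * (x - y)).
Proof. by rewrite mulrBr sinB /X /Y /mxX /dt; ring. Qed.

(** The adjugate matrix recovers the original vector up to the determinant: image vectors are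
    nonzero, and the action is invertible. *)
Lemma mx_inv_cos x : s * X x - q * Y x = dt * cos (pi * x).
Proof. by rewrite /X /Y /mxX /dt; ring. Qed.

Lemma mx_inv_sin x : - r * X x + p * Y x = dt * sin (pi * x).
Proof. by rewrite /X /Y /mxX /dt; ring. Qed.

Lemma mxN_gt0 x : 0 < N x.
Proof.
rewrite lt_neqAle addr_ge0 ?sqr_ge0// andbT eq_sym; apply/negP.
rewrite paddr_eq0 ?sqr_ge0// !sqrf_eq0 => /andP[/eqP X0 /eqP Y0].
have := mx_inv_cos x; have := mx_inv_sin x; rewrite /X /Y X0 Y0 !mulr0 addr0 subr0.
move=> /esym/eqP; rewrite mulf_eq0 gt_eqF//= => /eqP s0.
move=> /esym/eqP; rewrite mulf_eq0 gt_eqF//= => /eqP c0.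
by have := cos2Dsin2 (pi * x); rewrite s0 c0 expr0n/= addr0 => /eqP; rewrite eq_sym oner_eq0.
Qed.

Lemma mxD_gt0 x : 0 < D x. Proof. by rewrite sqrtr_gt0 mxN_gt0. Qed.

Lemma mxD_sqr x : D x * D x = N x.
Proof. by rewrite -expr2 sqr_sqrtr// ltW// mxN_gt0. Qed.

Lemma continuous_mxN : continuous N.
Proof.
move=> x; apply: cvgD; apply: cvgM; exact: continuous_mxX.
Qed.

Lemma continuous_mxD : continuous D.
Proof. by move=> x; apply: continuous_comp; [exact: continuous_mxN|exact: sqrt_continuous]. Qed.

(* The direction of the image of [(cos (pi x), sin (pi x))] under the matrix
   [[p, q], [r, s]] is [pi * Th x]; the choice of [Th] need not be continuous. *)
Definition mx_angle (Th : R -> R) := forall x,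
  cos (pi * Th x) * Num.sqrt (mxN x) = mxX p q x /\
  sin (pi * Th x) * Num.sqrt (mxN x) = mxX r s x.

Lemma mx_angle_exists : exists Th, mx_angle Th.
Proof.
by have [Th H] := boolp.choice (fun x => polar_coordinates (mxN_gt0 x)); exists Th.
Qed.

Variable Th : R -> R.
Hypothesis ThP : mx_angle Th.

Lemma mx_angle_sin x y :
  sin (pi * (Th x - Th y)) = dt * sin (pi * (x - y)) / (D x * D y).
Proof.
have [<- D0] := (mx_sin x y, mxD_gt0); rewrite /X /Y.
have [<- <-] := ThP x; have [<- <-] := ThP y.
by rewrite -/N -/(D x) -/(D y) mulrBr sinB; field; rewrite !lt0r_neq0.
Qed.

Lemma mx_angle_cos x y :
  cos (pi * (Th x - Th y)) = (X x * X y + Y x * Y y) / (D x * D y).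
Proof.
rewrite /X /Y; have [<- <-] := ThP x; have [<- <-] := ThP y; have D0 := mxD_gt0.
by rewrite -/N -/(D x) -/(D y) mulrBr cosB; field; rewrite !lt0r_neq0.
Qed.

Definition mx_circle (t : circle R) : circle R := to_circle (Th (circle_val t)).

Lemma mx_circle_lift : is_lift mx_circle Th.
Proof.
move=> x; rewrite /mx_circle; have [n ->] := circle_val_to_circle x.
have /sin_pi_eq0_int[m e] : sin (pi * (Th (x + n%:~R) - Th x)) = 0.
  rewrite mx_angle_sin addrAC subrr.
  apply/eqP; rewrite mulf_eq0 mulf_eq0 -(normr_eq0 (sin _)) norm_sin_pi_shift.
  by rewrite mulr0 sin0 normr0 eqxx orbT.
by apply/to_circle_eqP; exists m; rewrite -e; ring.
Qed.

(** [Th] may be discontinuous and cannot be differentiated. But the sine of pi times the chart is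
    the explicit smooth expression [S], so near 0 the chart is asin(S h) / pi. *)
Lemma mx_circle_derive x :
  is_derive (0 : R) 1 (in_chart mx_circle (to_circle x)) (dt / N x).
Proof.
have D0 := mxD_gt0.
pose S h := dt * sin (pi * h) * (D (x + h) * D x)^-1.
have cT (f : R -> R) : continuous f -> {for (0 : R), continuous (fun h => f (x + h))}.
  move=> cf; apply: continuous_comp; last exact: cf.
  by apply: cvgD; [exact: cvg_cst|exact: cvg_id].
have S0 : S 0 = 0 by rewrite /S mulr0 sin0 mulr0 mul0r.
have dS : is_derive (0 : R) 1 S (pi * (dt / N x)).
  have -> : pi * (dt / N x) = dt * pi * (D (x + 0) * D x)^-1.
    by rewrite addr0 mxD_sqr; ring.
  apply: (@is_derive_mulr_vanish R (fun h => dt * sin (pi * h)) (fun h => (D (x + h) * D x)^-1)).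
  - by rewrite mulr0 sin0 mulr0.
  - have d1 : is_derive (0 : R) 1 (fun h : R => pi * h) pi.
      by apply: is_derive_eq; rewrite /GRing.scale/=; ring.
    have d2 : is_derive (0 : R) 1 (fun h => sin (pi * h)) (1 * pi).
      have -> : 1 * pi = cos (pi * 0) * pi :> R by rewrite mulr0 cos0.
      exact: (@is_derive1_comp _ sin).
    by apply: is_derive_eq; rewrite /GRing.scale/=; ring.
  - apply: cvgV; first by rewrite lt0r_neq0// mulr_gt0.
    by apply: cvgM; [exact: cT continuous_mxD|exact: cvg_cst].
have cos_near : \forall h \near (0 : R), 0 < X (x + h) * X x + Y (x + h) * Y x.
  have : {for (0 : R), continuous (fun h => X (x + h) * X x + Y (x + h) * Y x)}.
    apply: cvgD; (apply: cvgM; last exact: cvg_cst); apply: cT; exact: continuous_mxX.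
  move=> /cvgr_gt; apply; rewrite addr0 -!expr2; exact: mxN_gt0.
apply: (@near_eq_is_derive _ _ _ (fun h => pi^-1 * asin (S h))); last first.
  have -> : dt / N x = pi^-1 * (1 * (pi * (dt / N x))).
    by rewrite [1 * _]mul1r mulKf// lt0r_neq0// pi_gt0.
  have : is_derive (0 : R) 1 (asin \o S) (1 * (pi * (dt / N x))).
    apply: is_derive1_comp; rewrite S0.
    have := @is_derive1_asin R 0; rewrite expr0n/= subr0 sqrtr1 invr1; apply.
    by rewrite ltrN10 ltr01.
  move=> d; exact: is_deriveZ.
near=> h.
have := in_chart_to_circle mx_circle x h.
have := signed_arc_itv (mx_circle (to_circle x)) (mx_circle (to_circle (x + h))).
rewrite -!mx_circle_lift => /[swap] <-.
have [n] := signed_arc_to_circle (Th x) (Th (x + h)).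
rewrite !mx_circle_lift -in_chart_to_circle.
set w := in_chart _ _ _ => wE /andP[w1 w2].
have [e e1 [se ce]] := sin_cos_pi_shift (Th (x + h) - Th x) n.
rewrite -wE in se ce.
have pi0 := @pi_gt0 R.
have pw : - (pi / 2) <= pi * w <= pi / 2.
  have := ler_wpM2l (ltW pi0) w1; have := ler_wpM2l (ltW pi0) (ltW w2).
  by rewrite mulrN => ? ?; apply/andP.
have c0 : 0 < cos (pi * (Th (x + h) - Th x)).
  by rewrite mx_angle_cos divr_gt0 ?mulr_gt0//; near: h.
(* The chart takes values in [-1/2, 1/2), where the cosine is nonnegative, and for small [h] the
   cosine of the unreduced angle is positive; this excludes the sign -1. *)
have e_eq1 : e = 1.
  have : 0 <= e by rewrite -(pmulr_lge0 _ c0) -ce; exact: cos_ge0_pihalf.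
  by move=> /ger0_norm <-; exact: norm_eq1_of_sqr.
have -> : S h = sin (pi * w).
  by rewrite se e_eq1 mul1r mx_angle_sin (_ : x + h - x = h)//; ring.
by rewrite sinK ?in_itv//= mulrA mulVf ?mul1r// lt0r_neq0.
Unshelve. all: by end_near. Qed.

Lemma mx_circle_C1 : C1 mx_circle /\ forall x, cderiv mx_circle (to_circle x) = dt / N x.
Proof.
apply: is_derive_C1 mx_circle_derive => x; apply: cvgM; first exact: cvg_cst.
by apply: cvgV; [rewrite lt0r_neq0 ?mxN_gt0|exact: continuous_mxN].
Qed.

Lemma mx_circle_sin_arc_len u v :
  sin (pi * arc_len (mx_circle u) (mx_circle v)) =
  dt * sin (pi * arc_len u v) / (D (circle_val u) * D (circle_val v)).
Proof.
have -> : arc_len u v = arc_len (to_circle (circle_val u)) (to_circle (circle_val v)).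
  by rewrite !to_circle_val.
rewrite !sin_arc_len mx_angle_sin !normrM normfV (gtr0_norm dt_gt0).
by rewrite (gtr0_norm (mulr_gt0 (mxD_gt0 _) (mxD_gt0 _))).
Qed.

(** The chord and the square root of the product of derivatives are both multiplied by det / (D D'),
    with D and D' the lengths at the two image points, and the factor cancels. *)
Lemma observable_mx_circle phi u v : C1 phi ->
  observable (mx_circle \o phi) u v = observable phi u v.
Proof.
move=> C1phi; have [C1mx mxE] := mx_circle_C1; have D0 := mxD_gt0.
have cdE t : cderiv (mx_circle \o phi) t = dt / N (circle_val (phi t)) * cderiv phi t.
  by rewrite cderiv_comp// -{1}(to_circle_val (phi t)) mxE.
rewrite /observable /= mx_circle_sin_arc_len !cdE -!mxD_sqr.
set Du := D _; set Dv := D (circle_val (phi u)).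
have Du0 : 0 < Du by exact: D0.
have Dv0 : 0 < Dv by exact: D0.
rewrite (_ : _ * cderiv phi v * _ = (dt / (Dv * Du)) ^+ 2 * (cderiv phi v * cderiv phi u)); last first.
  by field; rewrite !lt0r_neq0.
rewrite sqrtrM ?sqr_ge0// sqrtr_sqr ger0_norm; last first.
  by rewrite ltW// divr_gt0 ?mulr_gt0.
(* If the two images coincide, both sides are 0 because the inverse of 0 is 0. *)
rewrite -/Dv; set S := sin _; have [->|S0] := eqVneq S 0; first by rewrite mulr0 mul0r invr0 !mulr0.
by field; rewrite S0 !lt0r_neq0.
Qed.

End circle_moebius.

(** * Matrix actions as conformal automorphisms; moving triples of points *)

Section circle_moebius_automorphism.
Context {R : realType}.
Implicit Types (x y p q r s : R).
Local Notation C := (Cplx R).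

Lemma mx_circleK p q r s (Th Th' : R -> R) : 0 < p * s - q * r ->
  mx_angle p q r s Th -> mx_angle s (- q) (- r) p Th' ->
  cancel (mx_circle Th) (mx_circle Th').
Proof.
move=> dt0 ThP Th'P t; have dt0' : 0 < s * p - - q * - r.
  by rewrite mulrNN (mulrC s).
rewrite -{1}(to_circle_val t) -{2}(to_circle_val t); move: (circle_val t) => x.
rewrite -(mx_circle_lift dt0 ThP) -(mx_circle_lift dt0' Th'P); set y := Th x.
suff /sin_pi_eq0_int[n e] : sin (pi * (Th' y - x)) = 0.
  by apply/esym/to_circle_eqP; exists n; rewrite -e; ring.
have D0 := mxD_gt0 dt0 x; have D0' := mxD_gt0 dt0' y.
set D := Num.sqrt _ in D0; set D' := Num.sqrt _ in D0'.
have [cy sy] := ThP x; have [cy' sy'] := Th'P y.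
have cE : cos (pi * Th' y) * D' * D = (p * s - q * r) * cos (pi * x).
  rewrite cy' /mxX mulrDl -!mulrA cy sy -(mx_inv_cos p q r s) mulNr; ring.
have sE : sin (pi * Th' y) * D' * D = (p * s - q * r) * sin (pi * x).
  by rewrite sy' /mxX mulrDl -!mulrA cy sy -(mx_inv_sin p q r s).
apply/eqP; rewrite -[_ == 0](mulrI_eq0 _ (mulfI (lt0r_neq0 D0))).
rewrite -[_ == 0](mulrI_eq0 _ (mulfI (lt0r_neq0 D0'))) mulrBr sinB; apply/eqP.
have -> : D' * (D * (sin (pi * Th' y) * cos (pi * x) - cos (pi * Th' y) * sin (pi * x)))
  = (sin (pi * Th' y) * D' * D) * cos (pi * x) - (cos (pi * Th' y) * D' * D) * sin (pi * x).
  by ring.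
by rewrite cE sE; ring.
Qed.

Lemma mx_circle_oriented p q r s (Th : R -> R) : 0 < p * s - q * r ->
  mx_angle p q r s Th -> oriented_C1_diffeo (mx_circle Th).
Proof.
move=> dt0 ThP; have dt0' : 0 < s * p - - q * - r by rewrite mulrNN (mulrC s).
have [Th' Th'P] := mx_angle_exists dt0'.
have [C1mx mxE] := mx_circle_C1 dt0 ThP.
exists (mx_circle Th'); split.
- exact: mx_circleK dt0 ThP Th'P.
- by apply: (mx_circleK dt0' Th'P); rewrite !opprK.
- exact: C1mx.
- by have [] := mx_circle_C1 dt0' Th'P.
- by move=> t; rewrite -(to_circle_val t) mxE divr_gt0// mxN_gt0.
Qed.

(** The square of the half-angle point cos(pi x) + i sin(pi x); squaring absorbs the sign left by
    the integer shift. *)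
Lemma circle_exp_to_circle x : circle_exp (to_circle x) =
  Complex (cos (pi * x) ^+ 2 - sin (pi * x) ^+ 2) (2 * (cos (pi * x) * sin (pi * x))) :> C.
Proof.
rewrite /circle_exp; have [n ->] := circle_val_to_circle x.
have [e e1 [se ce]] := sin_cos_pi_shift x n.
have -> y : 2 * pi * y = (pi * y) *+ 2 by rewrite -mulr_natl; ring.
rewrite cos_mulr2n sin_mulr2n se ce; congr Complex.
  by rewrite !exprMn !expr2 e1 mul1r -!expr2 sin2cos2 -mulr_natl; ring.
by rewrite mulrACA e1 mul1r mulr_natl.
Qed.

(** On C = R^2 the matrix is the real-linear map w -> a w + b conj(w), with |a|^2 - |b|^2 its
    determinant. For |w| = 1, W = w^2 and Z the image of w, one gets a W + b = w Z, while the
    denominator is w conj(Z). So the Moebius map sends W to Z / conj(Z), the square of the direction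
    of Z. *)
Lemma mx_circle_PSL2R p q r s (Th : R -> R) : 0 < p * s - q * r ->
  mx_angle p q r s Th -> PSL2R (mx_circle Th).
Proof.
move=> dt0 ThP.
pose a : C := Complex ((p + s) / 2) ((r - q) / 2).
pose b : C := Complex ((p - s) / 2) ((r + q) / 2).
have ba : `|b| < `|a|.
  rewrite -ltr_sqr ?nnegrE// -subr_gt0 !normCK.
  have -> : a * a^* - b * b^* = Complex (p * s - q * r) 0 :> C.
    by apply/eqP; rewrite eq_complex /=; apply/andP; split; apply/eqP; field.
  by rewrite ltcE /= eqxx.
exists (moebius a b); first exact: moebius_automorphism.
move=> t; rewrite -(to_circle_val t); move: (circle_val t) => x.
have den0 := moebius_denom_neq0 ba (circle_exp_closed (to_circle x)).
rewrite -(mx_circle_lift dt0 ThP).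
apply: (mulIf den0); rewrite divfK//; move: den0 => _.
rewrite !circle_exp_to_circle.
have [cy sy] := ThP x; have D0 := mxD_gt0 dt0 x.
have cs := cos2Dsin2 (pi * x); have cs' := cos2Dsin2 (pi * Th x).
move: cy sy D0 cs cs'; rewrite /mxX.
set c := cos (pi * x); set d := sin (pi * x).
set c' := cos (pi * Th x); set d' := sin (pi * Th x); set D := Num.sqrt _.
move=> cy sy D0 cs cs'.
pose W : C := Complex (c ^+ 2 - d ^+ 2) (2 * (c * d)).
pose E : C := Complex (c' ^+ 2 - d' ^+ 2) (2 * (c' * d')).
pose w : C := Complex c d.
pose Z : C := Complex (c' * D) (d' * D).
have num : a * W + b = w * Z.
  rewrite /Z cy sy (_ : b = Complex ((p - s) / 2 * (c ^+ 2 + d ^+ 2))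
    ((r + q) / 2 * (c ^+ 2 + d ^+ 2))); last by rewrite cs !mulr1.
  by apply/eqP; rewrite eq_complex /=; apply/andP; split; apply/eqP; field.
have den : b^* * W + a^* = w * Z^*.
  rewrite /Z cy sy (_ : a = Complex ((p + s) / 2 * (c ^+ 2 + d ^+ 2))
    ((r - q) / 2 * (c ^+ 2 + d ^+ 2))); last by rewrite cs !mulr1.
  by apply/eqP; rewrite eq_complex /=; apply/andP; split; apply/eqP; field.
have EZ : E * Z^* = Z.
  apply/eqP; rewrite eq_complex /=; apply/andP; split; apply/eqP.
    by rewrite -[RHS]mulr1 -[X in _ = _ * X]cs'; ring.
  by rewrite -[RHS]mulr1 -[X in _ = _ * X]cs'; ring.
by rewrite -/W -/E num den mulrCA EZ.
Qed.

Lemma sin_cos_piquarter : sin (pi / 4) = cos (pi / 4) :> R.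
Proof.
by rewrite -[RHS]cosN -cosBpihalf; congr cos; field.
Qed.

(* The matrix sends the lines at angles [pi y0], [pi y1], [pi y2] to those at
   angles [0], [pi / 4], [pi / 2]. *)
Lemma mx_circle_normalize (y0 y1 y2 : R) : y0 < y1 -> y1 < y2 -> y2 < y0 + 1 ->
  exists p q r s Th, [/\ 0 < p * s - q * r, mx_angle p q r s Th,
    to_circle (Th y0) = to_circle 0, to_circle (Th y1) = to_circle (1 / 4)
    & to_circle (Th y2) = to_circle (1 / 2)].
Proof.
move=> y01 y12 y20.
have sin_gt0 u : 0 < u < 1 -> 0 < sin (pi * u).
  move=> /andP[u0 u1]; apply: sin_gt0_pi.
  by rewrite mulr_gt0 ?pi_gt0//= gtr_pMr ?pi_gt0.
have l0 : 0 < sin (pi * (y1 - y0)) by apply: sin_gt0; apply/andP; split; lra.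
have m0 : 0 < sin (pi * (y2 - y1)) by apply: sin_gt0; apply/andP; split; lra.
have n0 : 0 < sin (pi * (y2 - y0)) by apply: sin_gt0; apply/andP; split; lra.
set l := sin _ in l0; set m := sin _ in m0.
(* The second row vanishes on the line of [y0] and the first on that of [y2]; the weights [l] and
   [m] make both coordinates equal to l m at [y1]. *)
pose p := l * sin (pi * y2); pose q := - (l * cos (pi * y2)).
pose r := - (m * sin (pi * y0)); pose s := m * cos (pi * y0).
have XE y : mxX p q y = l * sin (pi * (y2 - y)).
  by rewrite mulrBr sinB /mxX /p /q; ring.
have YE y : mxX r s y = m * sin (pi * (y - y0)).
  by rewrite mulrBr sinB /mxX /r /s; ring.
have dt0 : 0 < p * s - q * r.
  have -> : p * s - q * r = l * m * sin (pi * (y2 - y0)).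
    by rewrite mulrBr sinB /p /q /r /s; ring.
  by rewrite !mulr_gt0.
have [Th ThP] := mx_angle_exists dt0.
exists p, q, r, s, Th; split=> //.
- have [_] := ThP y0; rewrite YE subrr mulr0 sin0 mulr0 => /eqP.
  rewrite mulf_eq0 (gt_eqF (mxD_gt0 dt0 y0)) orbF => /eqP /sin_pi_eq0_int[n ->].
  by rewrite -[in LHS](add0r n%:~R) to_circleDz.
- have [cE sE] := ThP y1.
  have : cos (pi * Th y1) * Num.sqrt (mxN p q r s y1) =
         sin (pi * Th y1) * Num.sqrt (mxN p q r s y1).
    by rewrite cE sE XE YE mulrC.
  move/(mulIf (lt0r_neq0 (mxD_gt0 dt0 y1))) => cs.
  have /sin_pi_eq0_int[n e] : sin (pi * (Th y1 - 1 / 4)) = 0.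
    by rewrite mulrBr mul1r sinB sin_cos_piquarter cs subrr.
  by rewrite -(subrK (1 / 4) (Th y1)) e addrC to_circleDz.
- have [+ _] := ThP y2; rewrite XE subrr mulr0 sin0 mulr0 => /eqP.
  rewrite mulf_eq0 (gt_eqF (mxD_gt0 dt0 y2)) orbF => /eqP cs.
  have /sin_pi_eq0_int[n e] : sin (pi * (Th y2 - 1 / 2)) = 0.
    by rewrite mulrBr mul1r sinB cs cos_pihalf mulr0 mul0r subrr.
  by rewrite -(subrK (1 / 2) (Th y2)) e addrC to_circleDz.
Qed.

End circle_moebius_automorphism.

(** * Normalization of representatives *)

Section hoelder_diffeo.
Context {R : realType}.
Implicit Types (s t : circle R) (x y : R) (phi : circle R -> circle R).

Lemma cdist_sin s t : cdist s t <= sin (pi * arc_len s t) <= 4 * cdist s t.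
Proof.
have [x tx e] := to_circle_dist_lift s t.
have d2 : `|circle_val s - x| <= 2^-1.
  have /andP[? ?] := signed_arc_itv s t.
  by rewrite distrC e cdist_signed_arc ler_norml; apply/andP; split; lra.
have -> : sin (pi * arc_len s t) = chord (circle_val s) x.
  by rewrite -{1}(to_circle_val s) tx sin_arc_len.
by rewrite -e distrC chord_le chord_ge_small.
Qed.

Lemma sin_arc_len_gt0 s t : s != t -> 0 < sin (pi * arc_len s t).
Proof. by move=> /cdist_gt0 /lt_le_trans; apply; have /andP[] := cdist_sin s t. Qed.

(** The bound is multiplied by q Q / pi. Writing d for the distance, d^(alpha - 1) q = d^alpha (q /
    d), where d <= q controls the power and q <= 4 d yields the constant 4. *)
Lemma Hol_bound_chord (alpha K : R) phi s t : 0 < alpha -> 0 <= K -> injective phi ->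
  (forall u, 0 < cderiv phi u) -> Hol_bound alpha K phi ->
  `|Num.sqrt (cderiv phi s) * Num.sqrt (cderiv phi t) * sin (pi * arc_len s t)
    - sin (pi * arc_len (phi s) (phi t))|
  <= 4 * K * sin (pi * arc_len s t) `^ alpha * sin (pi * arc_len (phi s) (phi t)).
Proof.
move=> a0 K0 phi_inj phi'0 H.
set q := sin (pi * arc_len s t); set Q := sin (pi * arc_len (phi s) (phi t)).
have [st|st] := eqVneq s t.
  have arc0 u : sin (pi * arc_len u u) = 0 by rewrite /arc_len lexx subrr mulr0 sin0.
  by rewrite /q /Q st !arc0 !mulr0 subrr normr0.
have q0 : 0 < q by exact: sin_arc_len_gt0.
have Q0 : 0 < Q by apply: sin_arc_len_gt0; rewrite (inj_eq phi_inj).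
have pi0 := @pi_gt0 R; have d0 := cdist_gt0 st.
have /andP[dq qd] := cdist_sin s t; rewrite -/q in dq qd.
have := H s t st; rewrite /observable -/q -/Q (mulrC (cderiv phi t)).
rewrite sqrtrM ?(ltW (phi'0 _))//; set S := _ * Num.sqrt _ => {}H; clearbody q Q S.
have -> : S * q - Q = (pi * S / Q - pi / q) * (q * Q / pi).
  move: (lt0r_neq0 pi0); move: (pi : R) => p p0.
  by field; rewrite p0 !lt0r_neq0.
rewrite normrM (ger0_norm (_ : 0 <= q * Q / pi)); last by rewrite divr_ge0 ?mulr_ge0 ?ltW.
apply: (le_trans (ler_wpM2r _ H)); first by rewrite divr_ge0 ?mulr_ge0 ?ltW.
have dE : cdist s t `^ (alpha - 1) = cdist s t `^ alpha / cdist s t.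
  rewrite powRD; last by rewrite (gt_eqF d0) implybT.
  by rewrite powR_inv1// ltW.
have da : cdist s t `^ alpha <= q `^ alpha.
  by apply: ge0_ler_powR; rewrite ?nnegrE// ltW.
have -> : K * cdist s t `^ (alpha - 1) * (q * Q / pi) =
    (K * Q) * (cdist s t `^ alpha * (q / cdist s t / pi)).
  rewrite dE; move: (lt0r_neq0 pi0); move: (pi : R) => p p0.
  by field; rewrite p0 lt0r_neq0.
rewrite [leRHS](_ : _ = K * Q * (q `^ alpha * 4)); last by ring.
rewrite ler_wpM2l ?mulr_ge0 ?(ltW Q0)// ler_pM ?powR_ge0 ?divr_ge0 ?(ltW q0) ?(ltW d0) ?(ltW pi0)//.
rewrite ler_pdivrMr// ler_pdivrMr//.
have : 4 * cdist s t * 1 <= 4 * cdist s t * pi.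
  by rewrite ler_wpM2l ?mulr_ge0 ?(ltW d0)//; have := @pi_ge2 R; lra.
lra.
Qed.

Definition fixes_quarter_points phi := [/\ phi (to_circle 0) = to_circle 0,
  phi (to_circle (1 / 4)) = to_circle (1 / 4)
  & phi (to_circle (1 / 2)) = to_circle (1 / 2)].

Lemma normalized_lift_exists (alpha K : R) phi : 0 < alpha -> 0 <= K ->
  oriented_C1_diffeo phi -> Hol_bound alpha K phi -> fixes_quarter_points phi ->
  exists2 F, is_lift phi F &
    normalized_lift (4 * K) alpha F (fun x => cderiv phi (to_circle x)).
Proof.
move=> a0 K0 phiD H [fix0 fix4 fix2].
have [F [lF F1 dF F0E]] := oriented_C1_diffeo_lift phiD.
have [psi [phiK _ _ _ phi'0]] := phiD.
have Finc := derive_gt0_increasing dF (fun x => phi'0 _).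
have F0 : F 0 = 0.
  rewrite F0E fix0; have [n nE] := circle_val_to_circle (0 : R).
  have := circle_valP (to_circle (0 : R)); rewrite nE add0r => /andP[? ?].
  by rewrite (@int_lt1_eq0 R n)//; lra.
have F1E : F 1 = 1 by rewrite -[X in F X]add0r F1 F0 add0r.
(* Fixing a point of the circle determines the lift only modulo integers; monotonicity between
   [F 0 = 0] and [F 1 = 1] selects the integer 0. *)
have Ffix x : 0 < x < 1 -> phi (to_circle x) = to_circle x -> F x = x.
  move=> /andP[x0 x1] fx; have := Finc _ _ x0; have := Finc _ _ x1; rewrite F0 F1E.
  have /esym/to_circle_eqP[n ->] : to_circle (F x) = to_circle x by rewrite lF.
  by move=> ? ?; rewrite (@int_lt1_eq0 R n) ?addr0//; lra.
exists F => //; split; last first.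
  by split=> //; apply: Ffix => //; apply/andP; split; lra.
split=> //.
- by move=> x; rewrite to_circleD1.
- move=> x y; have := Hol_bound_chord (to_circle x) (to_circle y) a0 K0 (can_inj phiK) phi'0 H.
  by rewrite /= -!lF !sin_arc_len.
Qed.

End hoelder_diffeo.

Section normalization.
Context {R : realType}.
Variables (alpha K : R).
Local Open Scope quotient_scope.

Definition normalized_Hol : set (Diff1 R) :=
  [set phi | Hol_bound alpha K phi /\ fixes_quarter_points phi].

Lemma normalization (phi : Diff1 R) : Hol_bound alpha K phi ->
  exists2 psi, normalized_Hol psi & psl_equiv psi phi.
Proof.
move=> H; have [phi' [phiK phi'K C1phi C1phi' phi0]] := diff1P phi.
have [F [lF F1 dF _]] := oriented_C1_diffeo_lift (diff1P phi).
have Finc := derive_gt0_increasing dF (fun x => phi0 _).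
have [|||p [q [r [s [Th [dt0 ThP e0 e1 e2]]]]]] := @mx_circle_normalize R (F 0) (F (1 / 4)) (F (1 / 2)).
- by apply: Finc; lra.
- by apply: Finc; lra.
- by rewrite -F1; apply: Finc; lra.
have lg := mx_circle_lift dt0 ThP.
pose psi := MkDiff1 (oriented_C1_diffeo_comp (diff1P phi) (mx_circle_oriented dt0 ThP)).
exists psi; last first.
  apply: psl_equiv_sym_imp; apply/asboolP; exists (mx_circle Th) => //.
  exact: mx_circle_PSL2R dt0 ThP.
split; last by split; rewrite /= -lF -lg.
by move=> u v uv; rewrite (observable_mx_circle dt0 ThP) //; exact: H.
Qed.

Lemma Hol_normalized :
  Hol alpha K = (\pi_(Diff1_PSL R) : Diff1 R -> Diff1_PSL R) @` normalized_Hol.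
Proof.
apply/seteqP; split=> q /=.
  move=> [phi <- /normalization[psi Npsi psiphi]]; exists psi => //.
  by apply/eqmodP.
by move=> [phi [H _] <-]; exists phi.
Qed.

End normalization.

(** * Limits of bounded functions along ultrafilters *)

Section ultralimits.
Context {R : realType} {T : Type} (U : set_system T).
Hypothesis UU : UltraFilter U.

(** A compact interval provides a cluster point, and for an ultrafilter a cluster point is a
    limit. *)
Lemma ultra_bounded_cvg (g : T -> R) (B : R) : (\forall p \near U, `|g p| <= B) ->
  exists l : R, g @ U --> l.
Proof.
move=> gB; have cB : compact `[- B, B]%classic by exact: segment_compact.
have [|l [_ cl]] := cB (g @ U) _ _.
  by apply: filterS gB => p; rewrite /= in_itv/= ler_norml.
exists l => V nV; have [//|UV] := in_ultra_setVsetC (g @^-1` V) UU.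
by have [y [/= yV]] := cl (~` V) V UV nV.
Qed.

End ultralimits.

(** * Ultrafilter limits *)

Section limits.
Context {R : realType}.

(** For each fixed [h] the remainder estimate is a closed condition on finitely many values, so in
    this form differentiability passes to pointwise limits. *)
Lemma is_derive_of_remainder (F : R -> R) (x l : R) :
  (forall e : R, 0 < e -> exists2 d : R, 0 < d &
    forall h, `|h| <= d -> `|F (x + h) - F x - l * h| <= e * `|h|) ->
  is_derive x 1 F l.
Proof.
move=> H; have cv : (fun h => h^-1 *: ((F \o shift x) (h *: 1) - F x)) @ 0^' --> l.
  apply/cvgrPdist_le => e e0; have [d d0 Hd] := H e e0.
  near=> h.
  have h0 : h != 0 by near: h; exact: nbhs_dnbhs_neq.
  have hd : `|h| <= d by near: h; apply: dnbhs0_le.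
  rewrite /= /GRing.scale/= mulr1 (addrC h).
  have -> : l - h^-1 * (F (x + h) - F x) = - (h^-1 * (F (x + h) - F x - l * h)).
    by field.
  rewrite normrN normrM normfV ler_pdivrMl ?normr_gt0// [leRHS]mulrC.
  exact: Hd.
apply: DeriveDef; first by apply/cvg_ex; exists l.
exact: cvg_lim.
Unshelve. all: by end_near. Qed.

Section filter_limits.
Context {T : Type} (U : set_system T).
Hypothesis UF : ProperFilter U.

Lemma cvg_norm_bound (g : T -> R) (l B : R) : g @ U --> l ->
  (\forall p \near U, `|g p| <= B) -> `|l| <= B.
Proof.
move=> /cvg_norm gl gB; rewrite -(cvg_lim (@Rhausdorff R) gl).
by apply: limr_le => //; exact: cvgP gl.
Qed.

Variables (N : set T) (h : T -> R -> R) (hl : R -> R).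
Hypotheses (UN : U N) (cvg_h : forall x, h p x @[p --> U] --> hl x).

Lemma limit_modulus (d e : R) :
  (forall p, N p -> forall s t, `|s - t| <= d -> `|h p s - h p t| <= e) ->
  forall s t, `|s - t| <= d -> `|hl s - hl t| <= e.
Proof.
move=> H s t st; apply: (@cvg_norm_bound (fun p => h p s - h p t)).
  by apply: cvgB; exact: cvg_h.
by apply: filterS UN => p /H; exact.
Qed.

(** The argument of Arzela and Ascoli: convergence holds simultaneously on the finite net k/n of
    mesh at most [d], and the modulus, inherited by the limit, carries it to all of [0,1). *)
Lemma equicontinuous_uniform_limit :
  (forall e : R, 0 < e -> exists2 d : R, 0 < d &
    forall p, N p -> forall s t, `|s - t| <= d -> `|h p s - h p t| <= e) ->
  forall e : R, 0 < e -> \forall p \near U, forall x, 0 <= x < 1 -> `|hl x - h p x| < e.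
Proof.
move=> H e e0; have [|d d0 Hd] := H (e / 4); first by rewrite divr_gt0.
have Hl := limit_modulus Hd.
pose n := (Num.truncn d^-1).+1.
have n0 : 0 < n%:R :> R by rewrite ltr0n.
have nd : n%:R^-1 <= d.
  rewrite -[leRHS]invrK lef_pV2 ?posrE ?invr_gt0//.
  by rewrite ltW// truncnS_gt// invr_ge0 ltW.
have net : \forall p \near U, forall k : 'I_n, `|hl (k%:R / n%:R) - h p (k%:R / n%:R)| < e / 4.
  apply: filter_forall => k.
  have /cvgr_dist_lt := @cvg_h (k%:R / n%:R); apply; by rewrite divr_gt0.
apply: filterS2 UN net => p Np net x /andP[x0 x1].
have kn : (Num.truncn (x * n%:R) < n)%N.
  rewrite -(ltr_nat R); apply: le_lt_trans (_ : x * n%:R < n%:R).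
    by rewrite truncn_le// mulr_ge0// ltW.
  by rewrite gtr_pMl.
have := net (Ordinal kn) => /=; set y := _%:R / n%:R => hy.
have xy : `|x - y| <= d.
  apply: le_trans nd.
  have xn0 : 0 <= x * n%:R by rewrite mulr_ge0// ltW.
  have -> : x - y = (x * n%:R - (Num.truncn (x * n%:R))%:R) / n%:R.
    by rewrite /y mulrBl mulfK// gt_eqF.
  rewrite normrM normfV (gtr0_norm n0) ler_piMl ?invr_ge0 ?ler0n//.
  have /andP[? ?] := truncn_itv xn0.
  by rewrite ger0_norm ?subr_ge0// lerBlDr addrC natr1 ltW.
have := Hl _ _ xy; have := Hd _ Np _ _ xy; move: hy.
rewrite distrC; move: (hl x) (h p x) (hl y) (h p y) => a b c f.
rewrite !ler_norml !ltr_norml => /andP[? ?] /andP[? ?] /andP[? ?].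
by apply/andP; split; lra.
Qed.

End filter_limits.

Lemma Diff1_cvg (U : set_system (Diff1 R)) (phi : Diff1 R) : Filter U ->
  (forall e : R, 0 < e -> \forall psi \near U, forall t : circle R,
    cdist (phi t) ((psi : Diff1 R) t) < e /\ `|cderiv phi t - cderiv psi t| < e) ->
  U --> phi.
Proof.
move=> UF H A [B [[V oV <-] VphiB] BA].
have : nbhs (C1_jet phi) V by exact: open_nbhs_nbhs.
move=> [[P Q] /= [/uniform_nbhs[E1 [entE1 PE1]] /uniform_nbhs[E2 [entE2 QE2]]] PQV].
move: entE1; rewrite -entourage_ballE => -[e1 /= e10 E1e].
move: entE2; rewrite -entourage_ballE => -[e2 /= e20 E2e].
have m0 : 0 < Num.min e1 e2 by rewrite lt_min e10.
apply: filterS (H _ m0) => psi psiP; apply: BA; apply: PQV; split.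
  apply: PE1 => t _; apply: E1e; rewrite /= ballEmdist /=.
  by have [] := psiP t; rewrite lt_min => /andP[].
apply: QE2 => t _; apply: E2e; rewrite /= /ball/=.
by have [_] := psiP t; rewrite lt_min => /andP[].
Qed.

End limits.

(** * Compactness of the normalized representatives and of their image *)

Section compactness.
Context {R : realType}.

(** By the mean value theorem the remainder is (f z - f x) h for some [z] between [x] and [x + h],
    so it is uniform over any family sharing a modulus for [f]. *)
Lemma derive_remainder (F f : R -> R) (x d e h : R) :
  (forall z : R, is_derive z 1 F (f z)) ->
  (forall z, `|x - z| <= d -> `|f x - f z| <= e) ->
  `|h| <= d -> `|F (x + h) - F x - f x * h| <= e * `|h|.
Proof.
move=> dF fe hd.
have [h0|h0|<-] := ltgtP 0 h; last by rewrite addr0 subrr mulr0 subr0 normr0 mulr0.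
- have [|z /andP[z1 z2] zE] := derive_MVT dF (_ : x < x + h); first lra.
  rewrite zE (_ : x + h - x = h); last by ring.
  rewrite -mulrBl normrM ler_wpM2r// distrC fe//.
  move: hd; rewrite gtr0_norm// => hd.
  by rewrite ler_norml; apply/andP; split; lra.
- have [|z /andP[z1 z2] zE] := derive_MVT dF (_ : x + h < x); first lra.
  rewrite -(opprB (F x)) zE (_ : _ - _ = (f z - f x) * h); last by ring.
  rewrite normrM ler_wpM2r// distrC fe//.
  move: hd; rewrite ltr0_norm// => hd.
  by rewrite ler_norml; apply/andP; split; lra.
Qed.

Lemma cvg_eventually_cst (T : Type) (U : set_system T) (UF : ProperFilter U)
    (g : T -> R) (l c : R) : g @ U --> l -> (\forall p \near U, g p = c) -> l = c.
Proof.
move=> gl gc; apply/eqP; rewrite -subr_eq0 -normr_le0.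
apply: (@cvg_norm_bound _ _ U UF (fun p => g p - c)).
  by apply: cvgB => //; exact: cvg_cst.
by apply: filterS gc => p ->; rewrite subrr normr0.
Qed.

Variables (alpha K : R).
Hypotheses (alpha0 : 0 < alpha) (K0 : 0 <= K).

Lemma normalized_Hol_compact : compact (normalized_Hol alpha K).
Proof.
rewrite compact_ultra => U UU UN; have UF : ProperFilter U := @ultra_proper _ U UU.
have K40 : 0 <= 4 * K by rewrite mulr_ge0.
set N := normalized_Hol alpha K in UN *.
pose f (phi : Diff1 R) x := cderiv phi (to_circle x).
(* One lift is fixed for each [phi], so that pointwise limits make sense; [id] is a dummy value
   outside [N]. *)
have /boolp.choice[L LP] : forall phi : Diff1 R, exists F : R -> R, N phi ->
    is_lift phi F /\ normalized_lift (4 * K) alpha F (f phi).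
  move=> phi; have [[H fixphi]|nN] := pselect (N phi); last by exists id.
  by have [F] := normalized_lift_exists alpha0 K0 (diff1P phi) H fixphi; exists F.
have [m m0 f_ge] := normalized_lift_deriv_ge K40 alpha0.
have f_le phi x : N phi -> f phi x <= ((1 + 4 * K) * 8) ^+ 2.
  by move=> /LP[_ NL]; exact: normalized_lift_deriv_le NL.
have L_lip phi x y : N phi -> `|L phi x - L phi y| <= ((1 + 4 * K) * 8) ^+ 2 * `|x - y|.
  by move=> /LP[_ NL]; exact: normalized_lift_lipschitz NL.
have [M M0 ME] : exists2 M, 0 < M & M = ((1 + 4 * K) * 8) ^+ 2.
  by eexists; last by []; rewrite exprn_gt0// mulr_gt0// ltr_pwDl.
rewrite -ME in f_le L_lip.
have f_eq (e : R) : 0 < e -> exists2 d : R, 0 < d &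
    forall phi, N phi -> forall s t, `|s - t| <= d -> `|f phi s - f phi t| <= e.
  move=> e0; have [d d0 H] := normalized_lift_equicontinuous K40 alpha0 e0.
  by exists d => // phi /LP[_ NL] s t; exact: H NL.
have L_eq (e : R) : 0 < e -> exists2 d : R, 0 < d &
    forall phi, N phi -> forall s t, `|s - t| <= d -> `|L phi s - L phi t| <= e.
  move=> e0; exists (e / M); first exact: divr_gt0.
  move=> phi Nphi s t st; apply: (le_trans (L_lip _ _ _ Nphi)).
  by rewrite mulrC -ler_pdivlMr.
have /boolp.choice[fl fl_cvg] : forall x, exists l : R, f phi x @[phi --> U] --> l.
  move=> x; apply: (ultra_bounded_cvg UU (B := M)).
  apply: filterS UN => phi Nphi; rewrite ger0_norm ?f_le//.
  by have [_ NL] := LP _ Nphi; exact: le_trans (ltW m0) (f_ge _ _ _ NL).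
have /boolp.choice[Fl Fl_cvg] : forall x, exists l : R, L phi x @[phi --> U] --> l.
  move=> x; apply: (ultra_bounded_cvg UU (B := M * `|x|)).
  apply: filterS UN => phi Nphi; have [_ [_ [L0 _ _]]] := LP _ Nphi.
  by have := L_lip _ x 0 Nphi; rewrite L0 !subr0.
(* The strict inequality [0 < f phi x] alone would not survive the limit; the uniform bound does. *)
have fl_ge x : m <= fl x.
  rewrite -(cvg_lim (@Rhausdorff R) (fl_cvg x)).
  apply: limr_ge; first exact: cvgP (fl_cvg x).
  by apply: filterS UN => phi /LP[_ NL]; exact: f_ge NL.
have fl_gt0 x : 0 < fl x by exact: lt_le_trans (fl_ge x).
have fl_cont : continuous fl.
  move=> x; apply/cvgrPdist_le => e e0; have [d d0 Hd] := f_eq e e0.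
  have := limit_modulus UF UN fl_cvg Hd => Hl.
  exists d => //= y; rewrite /ball_/= => /ltW; exact: Hl.
have Fl1 x : Fl (x + 1) = Fl x + 1.
  rewrite -(subrK (Fl x) (Fl (x + 1))) addrC; congr (_ + _).
  apply: (cvg_eventually_cst UF (g := fun phi => L phi (x + 1) - L phi x)).
    by apply: cvgB; exact: Fl_cvg.
  by apply: filterS UN => phi /LP[_ [[L1 _ _ _ _] _]] /=; rewrite L1; ring.
(* The radius [d] serves all [phi] in [N], so the remainder estimate can be passed to the limit at
   each fixed [h]. *)
have dFl (x : R) : is_derive x 1 Fl (fl x).
  apply: is_derive_of_remainder => e e0; have [d d0 Hd] := f_eq e e0.
  exists d => // h hd.
  apply: (@cvg_norm_bound _ _ U UF (fun phi => L phi (x + h) - L phi x - f phi x * h)).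
    apply: cvgB; first by apply: cvgB; exact: Fl_cvg.
    by apply: cvgM; [exact: fl_cvg|exact: cvg_cst].
  apply: filterS UN => phi Nphi; have [_ [[_ _ dL _ _] _]] := LP _ Nphi.
  by apply: derive_remainder dL _ hd => z; exact: Hd.
have lFl := is_lift_to_circle Fl1.
have [_ cdl] := lift_C1 lFl dFl fl_cont.
pose phil := MkDiff1 (lift_oriented_C1_diffeo Fl1 dFl fl_cont fl_gt0).
have lphil : is_lift phil Fl := lFl.
have {}cdl x : cderiv phil (to_circle x) = fl x := cdl x.
clearbody phil.
have phil_inj : injective phil.
  by have [psi [phiK _ _ _ _]] := diff1P phil; exact: can_inj phiK.
exists phil; split; last first.
  apply: Diff1_cvg => e e0.
  have Uf := equicontinuous_uniform_limit UF UN fl_cvg f_eq e0.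
  have UL := equicontinuous_uniform_limit UF UN Fl_cvg L_eq e0.
  near=> phi => t.
  have Nphi : N phi by near: phi.
  rewrite -(to_circle_val t); have tI := circle_valP t; move: (circle_val t) tI => x xI.
  have [lL _] := LP _ Nphi; split; last first.
    by rewrite cdl; move: x xI; near: phi.
  rewrite -lL -lphil; apply: le_lt_trans (cdist_to_circle_le _ _) _.
  by move: x xI; near: phi.
split; last first.
  have fixq x : (forall phi, N phi -> L phi x = x) -> phil (to_circle x) = to_circle x.
    move=> Lx; rewrite -lphil; congr to_circle.
    by apply: (cvg_eventually_cst UF (Fl_cvg x)); apply: filterS UN.
  by split; apply: fixq => phi /LP[_ [_ []]].
move=> s t st.
rewrite -(to_circle_val s) -(to_circle_val t) in st *.
move: (circle_val s) (circle_val t) st => x y xy.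
(* Injectivity of the limit keeps this denominator nonzero, so the observables converge and the
   closed Hoelder bound is inherited. *)
have sin0 : `|sin (pi * (Fl x - Fl y))| != 0.
  rewrite -sin_arc_len !lphil lt0r_neq0//.
  by apply: sin_arc_len_gt0; rewrite (inj_eq phil_inj).
apply: (@cvg_norm_bound _ _ U UF
  (fun phi => observable phi (to_circle x) (to_circle y)
     - pi / sin (pi * arc_len (to_circle x) (to_circle y)))); last first.
  by apply: filterS UN => phi [H _]; exact: H.
apply: cvgB; last exact: cvg_cst.
rewrite /observable -!lphil sin_arc_len !cdl.
apply: (@cvg_trans _ (pi * Num.sqrt (f phi y * f phi x)
    / `|sin (pi * (L phi x - L phi y))| @[phi --> U])).
  apply: near_eq_cvg; apply: filterS UN => phi Nphi.
  by have [lL _] := LP _ Nphi; rewrite -!lL sin_arc_len.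
apply: cvgM.
  apply: cvgM; first exact: cvg_cst.
  apply: continuous_cvg; first exact: sqrt_continuous.
  by apply: cvgM; exact: fl_cvg.
apply: cvgV => //; apply: cvg_norm; apply: continuous_cvg; first exact: continuous_sin.
by apply: cvgM; [exact: cvg_cst|apply: cvgB; exact: Fl_cvg].
Unshelve. all: by end_near. Qed.

End compactness.

Theorem corollary16 (R : realType) (alpha K : R) :
  0 < alpha < 1 -> 0 < K -> compact (Hol alpha K).
Proof.
move=> /andP[alpha0 _] K0; rewrite Hol_normalized.
apply: continuous_compact; last exact: normalized_Hol_compact alpha0 (ltW K0).
by apply: continuous_subspaceT => phi; exact: pi_continuous.
Qed.
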